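(* Let $\Lambda_1$ and $\Lambda_2$ be the nuisance tangent spaces, at the truth $(\beta_0,g_0,\eta_0)$ of the proportional likelihood ratio model, with respect to $g(\cdot)$ and $\eta(\cdot)$, respectively. For $a(Y,X)\in\mathcal{H}$, the respective orthogonal projections of $a(Y,X)$ on $\Lambda_1$ and $\Lambda_2$ are (i) $\Pi\{a(Y,X)\mid\Lambda_1\}=(I-\mathcal{B})^{-1}\mathcal{K}\{a(Y,X)\}-E\left[(I-\mathcal{B})^{-1}\mathcal{K}\{a(Y,X)\}\mid X\right]$; (ii) $\Pi\{a(Y,X)\mid\Lambda_2\}=E\{a(Y,X)\mid X\}$.
   Context: Model. $Y$ is a real-valued response and $X$ is an $\mathbb{R}^q$-valued covariate. The proportional likelihood ratio model is the set $\mathcal{P}$ of joint densities $$p_{Y,X}\{y,x;\beta,g(\cdot),\eta(\cdot)\}=\frac{\exp(\beta^T x y)\,g(y)}{\int \exp(\beta^T x y)\,dG(y)}\,\eta(x),$$ where $\beta\in\mathbb{R}^q$ is the parameter of interest, $g$ is a density with respect to a dominating measure $\nu$ with distribution function $G$ (the conditional distribution of $Y$ given $X=0$), and $\eta$ is the density of $X$ with respect to some dominating measure; $g$ and $\eta$ are unrestricted infinite-dimensional nuisance parameters. True values are $\beta_0,g_0,\eta_0$; all expectations and conditional expectations are taken under the true distribution. The standard smoothness and regularity conditions of semiparametric theory are assumed throughout for the model and for parametric submodels (e.g. mean-square differentiability of the root density with respect to the finite-dimensional parameter, finite-variance scores, nonsingular information). Hilbert space. $\mathcal{H}$ is the Hilbert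 space of all $q$-dimensional (measurable) random functions $a(Y,X)$ with $E\{a(Y,X)\}=0$ and finite variance, with inner product $\langle a_1,a_2\rangle=E(a_1^Ta_2)$. $\Pi(a\mid\Lambda)$ denotes the orthogonal projection in $\mathcal{H}$ of $a$ on $\Lambda$. Nuisance tangent spaces. A parametric submodel for $g$ is a smooth family $g(\cdot;\gamma)$, $\gamma\in\mathbb{R}^r$, of densities with $g(\cdot;\gamma_0)=g_0$ for some $\gamma_0$; its nuisance score is $S_\gamma(y,x)=\partial_\gamma\log p_{Y,X}\{y,x;\beta_0,g(\cdot;\gamma),\eta_0\}|_{\gamma=\gamma_0}$. $\Lambda_1\subset\mathcal{H}$ is the mean-square closure of the set of all elements $C\,S_\gamma(Y,X)$ over all such parametric submodels and all constant $q\times r$ matrices $C$. $\Lambda_2$ is defined in the same way using parametric submodels $\eta(\cdot;\gamma)$ for $\eta$ with $g=g_0$ fixed. Operators. $\mathcal{K}\{a(Y,X)\}=E\{a(Y,X)\mid Y\}-E[E\{a(Y,X)\mid X\}\mid Y]$; $\mathcal{B}\{f(Y)\}=E[E\{f(Y)\mid X\}\mid Y]$ (a linear operator on functions of $Y$); $I$ is the identity. $(I-\mathcal{B})^{-1}$ is the inverse of $I-\mathcal{B}$ acting on mean-zero, finite-variance $q$-dimensional functions of $Y$. *)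

(* Defs.v *)
From HB Require Import structures.
From mathcomp Require Import all_boot all_order all_algebra.
From mathcomp Require Import all_classical all_reals all_analysis.

Set Implicit Arguments.
Unset Strict Implicit.
Unset Printing Implicit Defensive.

Import Order.TTheory GRing.Theory Num.Theory.
Import numFieldNormedType.Exports.

Local Open Scope classical_set_scope.
Local Open Scope ring_scope.

(* R^q is q.-tuple R as the space of values of the covariate (it carries the
   product sigma-algebra) and 'cV[R]_q elsewhere. *)

Section vectors.
Context {R : realType}.

Definition dotv n (u v : 'cV[R]_n) : R := (u^T *m v) 0 0.

Definition vec_of_tuple q (x : q.-tuple R) : 'cV[R]_q := \col_i tnth x i.

End vectors.

Section conditional_expectation.
Context d d' (T : measurableType d) (U : measurableType d') (R : realType).
Variables (P : probability T R) (Z : T -> U).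

(* [h] is a version of z |-> E(f | Z = z). *)
Definition is_condE (f : T -> R) (h : U -> R) : Prop :=
  [/\ measurable_fun setT h,
      P.-integrable setT (EFin \o (h \o Z)) &
      forall B : set U, measurable B ->
        (\int[P]_(w in Z @^-1` B) (f w)%:E =
         \int[P]_(w in Z @^-1` B) (h (Z w))%:E)%E].

(* E(f | Z) as a function on T; versions exist for every integrable [f] and
   are almost surely unique. *)
Definition condE1 (f : T -> R) : T -> R := xget (cst 0) (is_condE f) \o Z.

Definition condE n (f : T -> 'cV[R]_n) : T -> 'cV[R]_n :=
  fun w => \col_i condE1 (fun w' => f w' i 0) w.

End conditional_expectation.

Section hilbert_space.
Context d (T : measurableType d) (R : realType).
Variable P : probability T R.

(* Elements of the Hilbert space are represented by functions; equality in the
   Hilbert space is P-almost sure equality. *)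
Definition Hspace n : set (T -> 'cV[R]_n) :=
  [set a : T -> 'cV[R]_n | [/\ forall i, measurable_fun setT (fun w => a w i 0),
               forall i, ('E_P[(fun w => a w i 0 ^+ 2)%R] < +oo)%E &
               forall i, ('E_P[(fun w => a w i 0)%R] = 0)%E]].

Definition inner n (a b : T -> 'cV[R]_n) : \bar R :=
  'E_P[(fun w => dotv (a w) (b w))%R]%E.

Definition ms_closure n (A : set (T -> 'cV[R]_n)) : set (T -> 'cV[R]_n) :=
  [set b : T -> 'cV[R]_n | Hspace b /\ forall e : R, 0 < e ->
     exists2 c, A c & (inner (b \- c)%R (b \- c)%R < e%:E)%E].

Definition is_orth_proj n (L : set (T -> 'cV[R]_n)) (a b : T -> 'cV[R]_n) : Prop :=
  L b /\ forall c, L c -> inner (a \- b) c = 0%E.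

End hilbert_space.

Section scores.
Context d (T : measurableType d) (R : realType).
Variables (m : {measure set T -> \bar R}) (P : probability T R).

(* [S] is the score at [c0] of the regular family [p] of densities with respect
   to [m], where [P] has density [p c0]: [S] is the gradient of log p at [c0], and
   the derivative in quadratic mean of the root density is S sqrt(p) / 2. The
   positivity clause keeps the convention ln 0 = 0 out of the derivative. *)
Definition is_score r (p : 'cV[R]_r -> T -> R) (c0 : 'cV[R]_r)
    (S : T -> 'cV[R]_r) : Prop :=
  [/\ forall j : 'I_r, {ae P, forall w,
        (\forall t \near (0 : R), 0 < p (c0 + t *: delta_mx j 0) w) /\
        is_derive (0 : R) (1 : R)
          (fun t : R => ln (p (c0 + t *: delta_mx j 0) w)) (S w j 0)},
      forall e : R, 0 < e -> exists2 del : R, 0 < del &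
        forall h : 'cV[R]_r, dotv h h < del ->
          (\int[m]_w ((Num.sqrt (p (c0 + h)%R w) - Num.sqrt (p c0 w)
             - 2^-1 * dotv h (S w) * Num.sqrt (p c0 w)) ^+ 2)%:E
           <= (e * dotv h h)%:E)%E,
      forall j : 'I_r, measurable_fun setT (fun w => S w j 0),
      forall j : 'I_r, ('E_P[(fun w => S w j 0 ^+ 2)%R] < +oo)%E &
      (\matrix_(i, j) fine ('E_P[(fun w => S w i 0 * S w j 0)%R])%E) \in unitmx].

End scores.

Section model.
Context (R : realType) (q : nat).
Variables (nu : {sigma_finite_measure set R -> \bar R})
  (mu : {sigma_finite_measure set (q.-tuple R) -> \bar R}).

Definition is_density d (T : measurableType d) (m : {measure set T -> \bar R})
    (f : T -> R) : Prop :=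
  [/\ measurable_fun setT f, forall x, 0 <= f x & (\int[m]_x (f x)%:E = 1)%E].

Implicit Types (b : 'cV[R]_q) (g : R -> R) (eta : q.-tuple R -> R).

(* The value +oo is allowed here; [plr_model] makes it almost surely finite. *)
Definition plr_norm b g (x : q.-tuple R) : \bar R :=
  (\int[nu]_y (expR (dotv b (vec_of_tuple x) * y) * g y)%:E)%E.

Definition plr_dens b g eta (yx : R * q.-tuple R) : R :=
  expR (dotv b (vec_of_tuple yx.2) * yx.1) * g yx.1
    / fine (plr_norm b g yx.2) * eta yx.2.

Definition plr_model b g eta : Prop :=
  [/\ is_density nu g, is_density mu eta &
      {ae mu, forall x, 0 < eta x -> (plr_norm b g x < +oo)%E}].

(* [P] is the law of (Y, X), so that Y = fst and X = snd. *)
Definition plr_law b g eta (P : probability (R * q.-tuple R)%type R) : Prop :=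
  forall A, measurable A ->
    P A = (\int[nu \x mu]_(z in A) (plr_dens b g eta z)%:E)%E.

(* In the next two definitions (b, g, eta) is the truth and [P] its law. *)
Definition nuisance_scores_g b g eta (P : probability (R * q.-tuple R)%type R) :
    set (R * q.-tuple R -> 'cV[R]_q) :=
  [set a : R * q.-tuple R -> 'cV[R]_q |
    exists r (gf : 'cV[R]_r -> R -> R) (c0 : 'cV[R]_r)
      (S : R * q.-tuple R -> 'cV[R]_r) (C : 'M[R]_(q, r)),
    [/\ gf c0 = g, forall c, plr_model b (gf c) eta,
        is_score (nu \x mu)%E P (fun c => plr_dens b (gf c) eta) c0 S &
        a = (fun w => C *m S w)]].

Definition nuisance_scores_eta b g eta (P : probability (R * q.-tuple R)%type R) :
    set (R * q.-tuple R -> 'cV[R]_q) :=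
  [set a : R * q.-tuple R -> 'cV[R]_q |
    exists r (ef : 'cV[R]_r -> q.-tuple R -> R) (c0 : 'cV[R]_r)
      (S : R * q.-tuple R -> 'cV[R]_r) (C : 'M[R]_(q, r)),
    [/\ ef c0 = eta, forall c, plr_model b g (ef c),
        is_score (nu \x mu)%E P (fun c => plr_dens b g (ef c)) c0 S &
        a = (fun w => C *m S w)]].

Definition Lambda1 b g eta P := ms_closure P (nuisance_scores_g b g eta P).

Definition Lambda2 b g eta P := ms_closure P (nuisance_scores_eta b g eta P).

End model.

Section operators.
Context (R : realType) (q : nat).
Variable P : probability (R * q.-tuple R)%type R.
Implicit Types a f h : R * q.-tuple R -> 'cV[R]_q.

Definition E_givenY a := condE P fst a.

Definition E_givenX a := condE P snd a.

Definition opK a : R * q.-tuple R -> 'cV[R]_q :=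
  E_givenY a \- E_givenY (E_givenX a).

Definition opB f : R * q.-tuple R -> 'cV[R]_q := E_givenY (E_givenX f).

(* Mean-zero, finite-variance functions of Y, as functions of (Y, X). *)
Definition L20Y : set (R * q.-tuple R -> 'cV[R]_q) :=
  [set f : R * q.-tuple R -> 'cV[R]_q |
    Hspace P f /\ exists phi : R -> 'cV[R]_q, f = phi \o fst].

Definition IB_preimage h : set (R * q.-tuple R -> 'cV[R]_q) :=
  [set f : R * q.-tuple R -> 'cV[R]_q |
    L20Y f /\ {ae P, forall w, (f \- opB f) w = h w}].

(* I - B need not be onto the mean-zero square-integrable functions of Y: it is
   not when the maximal correlation of X and Y is 1. So its inverse is an
   operator with a domain. Preimages are almost surely unique, because the law of
   (Y, X) in the model is equivalent to the product of its marginals. *)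
Definition IBinv_dom h : Prop := exists f, IB_preimage h f.

Definition IBinv h : R * q.-tuple R -> 'cV[R]_q := xget (cst 0) (IB_preimage h).

End operators.

(* Main.v *)
(* A score for eta is almost surely a function of X, and perturbing eta by
   1 + c.s, with s bounded and centred, shows that every bounded centred function
   of X is such a score; by density, Lambda2 consists of the centred functions of X.

   A score S for g has the form s(Y) - n(X) and satisfies E(S | X) = 0: the law of
   X does not depend on g, and differentiability in quadratic mean lets one
   differentiate this identity.  Neither s(Y) nor n(X) has to be square-integrable,
   but truncating both approximates S in L2, truncation being 1-Lipschitz.  Hence
   S is orthogonal to every D in L2 with E(D | X) = E(D | Y) = 0.  For
   f = (I - B)^-1 K a, the equation f - B f = K a says that
   D = (a - f) - E(a - f | X) satisfies E(D | Y) = 0, and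
   a - (f - E(f | X)) = D + E(a | X) is therefore orthogonal to S.  Conversely
   f - E(f | X) is the limit of the scores s - E(s | X) of the submodels
   g (1 + c.s), where s(Y) is bounded and tends to f.

   The information of a submodel has to be nonsingular, so the components of s
   are first replaced by linear combinations with an invertible Gram matrix which
   still span all of them. *)

Require Import Defs.
From HB Require Import structures.
From mathcomp Require Import all_boot all_order all_algebra.
From mathcomp Require Import all_classical all_reals all_analysis.
From mathcomp Require Import measurable_realfun.
From mathcomp Require Import ring lra.

Set Implicit Arguments.
Unset Strict Implicit.
Unset Printing Implicit Defensive.

Import Order.TTheory GRing.Theory Num.Theory.
Import numFieldNormedType.Exports.

Local Open Scope classical_set_scope.
Local Open Scope ring_scope.

(** * Square-integrable functions *)

Section square_integrable.
Context d (T : measurableType d) (R : realType).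
Variable m : {measure set T -> \bar R}.
Implicit Types f g : T -> R.

(** The obstacles are analytic. A submodel has to lie in the model for every parameter in R^r, so
    the perturbations 1 + c.s are switched off outside a ball on which |c.s| <= 1/2; a score sees
    only a neighbourhood of its base point. Perturbing g also changes the normaliser, so both kinds
    of submodel have densities of the form p (1 + c.s) / (1 + c.n), with n = 0 for eta, and one
    second-order bound on the square root of such a ratio gives differentiability in quadratic mean
    for both. In the other direction, the log-derivative of an arbitrary g-submodel is a limit of
    A_k(Y) - B_k(X) in which neither sequence need converge. Separating the variables relies on the
    conditional laws of Y given X = x sharing their null sets, because the exponential tilt never
    vanishes. Membership in a closure and orthogonality to it are handled by explicit error budgets,
    with weighted AM-GM in place of Cauchy-Schwarz. *)

Definition integrableR f := m.-integrable setT (EFin \o f).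

Definition square_integrable f :=
  measurable_fun setT f /\ integrableR (fun x => f x ^+ 2).

Lemma integrableR_le f g : measurable_fun setT f ->
  (forall x, `|f x| <= g x) -> integrableR g -> integrableR f.
Proof.
move=> mf fg; apply: le_integrable => //; first exact/measurable_EFinP.
by move=> x _ /=; rewrite lee_fin (le_trans (fg x))// ler_norm.
Qed.

Lemma integrableR_measurable f : integrableR f -> measurable_fun setT f.
Proof. by move=> /measurable_int/measurable_EFinP. Qed.

Lemma integrableRD f g : integrableR f -> integrableR g ->
  integrableR (fun x => f x + g x).
Proof. by move=> iF ig; apply: (integrableD _ iF ig). Qed.

Lemma integrableRB f g : integrableR f -> integrableR g ->
  integrableR (fun x => f x - g x).
Proof. by move=> iF ig; apply: (integrableB _ iF ig). Qed.

Lemma integrableRZ c f : integrableR f -> integrableR (fun x => c * f x).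
Proof. by move=> iF; apply: (integrableZl _ c iF). Qed.

Lemma integrableR_eq f g : f =1 g -> integrableR f -> integrableR g.
Proof. by move=> /funext ->. Qed.

Lemma integrableR_sum (I : Type) (s : seq I) (F : I -> T -> R) :
  (forall i, integrableR (F i)) -> integrableR (fun x => \sum_(i <- s) F i x).
Proof.
move=> iF; elim: s => [|i s IH].
  apply: integrableR_eq (integrable0 _ _) => x; by rewrite big_nil.
apply: integrableR_eq (integrableRD (iF i) IH) => x; by rewrite big_cons.
Qed.

Lemma Rintegral_sum (I : Type) (s : seq I) (F : I -> T -> R) :
  (forall i, integrableR (F i)) ->
  \int[m]_x (\sum_(i <- s) F i x) = \sum_(i <- s) \int[m]_x (F i x).
Proof.
move=> iF; elim: s => [|i s IH].
  rewrite big_nil; under eq_Rintegral do rewrite big_nil.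
  by rewrite /Rintegral integral0.
rewrite big_cons -IH -RintegralD//.
- by apply: eq_Rintegral => x _; rewrite big_cons.
- exact: iF.
- exact: integrableR_sum.
Qed.

Lemma square_integrable_eq f g :
  f =1 g -> square_integrable f -> square_integrable g.
Proof. by move=> /funext ->. Qed.

Lemma square_integrableM f g : square_integrable f -> square_integrable g ->
  integrableR (fun x => f x * g x).
Proof.
move=> [mf f2] [mg g2]; apply: integrableR_le (integrableRD f2 g2).
  exact: measurable_funM.
move=> x; rewrite ler_norml; apply/andP; split; nra.
Qed.

Lemma square_integrableD f g : square_integrable f -> square_integrable g ->
  square_integrable (fun x => f x + g x).
Proof.
move=> sf sg; have fg := square_integrableM sf sg.
case: sf sg => [mf f2] [mg g2]; split; first exact: measurable_funD.
apply: integrableR_eq (integrableRD (integrableRD f2 g2) (integrableRZ 2 fg)).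
by move=> x; ring.
Qed.

Lemma square_integrableZ c f : square_integrable f ->
  square_integrable (fun x => c * f x).
Proof.
move=> [mf f2]; split; first exact: measurable_funM.
by apply: integrableR_eq (integrableRZ (c ^+ 2) f2) => x; rewrite exprMn.
Qed.

Lemma square_integrableB f g : square_integrable f -> square_integrable g ->
  square_integrable (fun x => f x - g x).
Proof.
move=> sf sg; have := square_integrableD sf (square_integrableZ (-1) sg).
by apply: square_integrable_eq => x; rewrite mulN1r.
Qed.

Lemma square_integrable0 : square_integrable (fun=> 0).
Proof.
split; first exact: measurable_cst.
by apply: integrableR_eq (integrable0 _ _) => x; rewrite expr0n.
Qed.

Lemma square_integrable_sum (I : Type) (s : seq I) (F : I -> T -> R) :
  (forall i, square_integrable (F i)) ->
  square_integrable (fun x => \sum_(i <- s) F i x).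
Proof.
move=> iF; elim: s => [|i s IH].
  by apply: square_integrable_eq square_integrable0 => x; rewrite big_nil.
apply: square_integrable_eq (square_integrableD (iF i) IH) => x.
by rewrite big_cons.
Qed.

Lemma Rintegral_sqr_ge0 f : 0 <= \int[m]_x (f x ^+ 2).
Proof. by apply: Rintegral_ge0 => x _; rewrite sqr_ge0. Qed.

(* AM-GM, with a free weight [k]. *)
Lemma Rintegral_mul_le f g k : 0 < k ->
  square_integrable f -> square_integrable g ->
  `|\int[m]_x (f x * g x)| <=
    k * \int[m]_x (f x ^+ 2) + k^-1 * \int[m]_x (g x ^+ 2).
Proof.
move=> k0 sf sg; have ifg := square_integrableM sf sg.
have [_ f2] := sf; have [_ g2] := sg.
apply: le_trans (le_normr_Rintegral _ ifg) _ => //.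
rewrite -!RintegralZl// -RintegralD//; first last.
- exact: integrableRZ.
- exact: integrableRZ.
apply: le_Rintegral => //.
- exact: integrable_norm.
- by apply: integrableRD; exact: integrableRZ.
move=> x _; set a := f x; set b := g x.
have k1 : k * k^-1 = 1 by rewrite divff// gt_eqF.
have k'0 : 0 < k^-1 by rewrite invr_gt0.
have h : 0 <= k^-1 * (k * a - b) ^+ 2 by rewrite mulr_ge0 ?sqr_ge0// ltW.
have h' : 0 <= k^-1 * (k * a + b) ^+ 2 by rewrite mulr_ge0 ?sqr_ge0// ltW.
have E : k^-1 * (k * a - b) ^+ 2 = k * a ^+ 2 + k^-1 * b ^+ 2 - 2 * (a * b).
  transitivity ((k * k^-1) * k * a ^+ 2 - 2 * (k * k^-1) * (a * b) + k^-1 * b ^+ 2).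
    by ring.
  by rewrite k1; ring.
have E' : k^-1 * (k * a + b) ^+ 2 = k * a ^+ 2 + k^-1 * b ^+ 2 + 2 * (a * b).
  transitivity ((k * k^-1) * k * a ^+ 2 + 2 * (k * k^-1) * (a * b) + k^-1 * b ^+ 2).
    by ring.
  by rewrite k1; ring.
have p1 : 0 <= k * a ^+ 2 by rewrite mulr_ge0 ?sqr_ge0// ltW.
have p2 : 0 <= k^-1 * b ^+ 2 by rewrite mulr_ge0 ?sqr_ge0// ltW.
rewrite E in h; rewrite E' in h'.
rewrite ler_norml; apply/andP; split; lra.
Qed.

Lemma Rintegral_sqrD_le f g : square_integrable f -> square_integrable g ->
  \int[m]_x ((f x + g x) ^+ 2) <=
    2 * \int[m]_x (f x ^+ 2) + 2 * \int[m]_x (g x ^+ 2).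
Proof.
move=> sf sg; have [_ fg2] := square_integrableD sf sg.
have [_ f2] := sf; have [_ g2] := sg.
rewrite -!RintegralZl// -RintegralD//; first last.
- exact: integrableRZ.
- exact: integrableRZ.
apply: le_Rintegral => //.
- by apply: integrableRD; exact: integrableRZ.
move=> x _; have := sqr_ge0 (f x - g x); nra.
Qed.

Lemma ae_eq_Rintegral f g : measurable_fun setT f -> measurable_fun setT g ->
  {ae m, forall x, f x = g x} -> \int[m]_x f x = \int[m]_x g x.
Proof.
move=> mf mg fg; congr fine; apply: ae_eq_integral => //; try exact/measurable_EFinP.
by apply: filterS fg => x /= ->.
Qed.

Lemma ae_integrableR f g : measurable_fun setT g ->
  {ae m, forall x, f x = g x} -> integrableR f -> integrableR g.
Proof.
move=> mg fg /integrableP [mf iF]; apply/integrableP; split.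
  exact/measurable_EFinP.
rewrite (_ : (\int[m]_x _)%E = (\int[m]_x `|(EFin \o f) x|)%E)//.
apply: ae_eq_integral => //.
- by apply: measurableT_comp => //; exact/measurable_EFinP.
- exact: measurableT_comp.
- by apply: filterS fg => x /= ->.
Qed.

Lemma ae_square_integrable f g : measurable_fun setT g ->
  {ae m, forall x, f x = g x} -> square_integrable f -> square_integrable g.
Proof.
move=> mg fg [mf f2]; split => //; apply: ae_integrableR f2.
  exact: measurable_funX.
by apply: filterS fg => x /= ->.
Qed.

Lemma Rintegral_sqr_eq0 f : square_integrable f ->
  \int[m]_x (f x ^+ 2) = 0 -> {ae m, forall x, f x = 0}.
Proof.
move=> [mf f2] f0; have : (\int[m]_x `|(f x ^+ 2)%:E| = 0)%E.
  under eq_integral do rewrite /= ger0_norm ?sqr_ge0//.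
  by rewrite -[LHS]fineK ?integrable_fin_num// -/(Rintegral _ _ _) f0.
have m2 : measurable_fun setT (EFin \o (fun x => f x ^+ 2)).
  by apply/measurable_EFinP; exact: measurable_funX.
move=> /(ae_eq_integral_abs _ measurableT m2); apply: filterS => x /= /(_ I) [].
by move=> /eqP; rewrite sqrf_eq0 => /eqP.
Qed.

End square_integrable.

Section dominated_convergence_real.
Context d (T : measurableType d) (R : realType).
Variable m : {measure set T -> \bar R}.

Lemma dominated_convergenceR (f_ : nat -> T -> R) (f g : T -> R) :
  (forall n, measurable_fun setT (f_ n)) -> measurable_fun setT f ->
  {ae m, forall x, f_ n x @[n --> \oo] --> f x} ->
  integrableR m g -> (forall n x, `|f_ n x| <= g x) ->
  \int[m]_x f_ n x @[n --> \oo] --> \int[m]_x f x.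
Proof.
move=> mf_ mf f_f ig f_g.
have [|||||iF _] := @dominated_convergence _ _ _ m setT measurableT
  (fun n => EFin \o f_ n) (EFin \o f) (EFin \o g).
- by move=> n; exact/measurable_EFinP.
- exact/measurable_EFinP.
- by apply: filterS f_f => x h _; apply/fine_cvgP; split; first exact: nearW.
- by [].
- by apply: aeW => x n _ /=; rewrite lee_fin.
- by rewrite -[X in _ --> X]fineK ?integrable_fin_num// => /fine_cvgP [].
Qed.

End dominated_convergence_real.

(** * Conditional expectations *)

Section conditional_expectation.
Context d d' (T : measurableType d) (U : measurableType d') (R : realType).
Variables (P : probability T R) (Z : T -> U).
Hypothesis mZ : measurable_fun setT Z.
Implicit Types (f g : T -> R) (h u : U -> R).

Let measurable_preimage B : measurable B -> measurable (Z @^-1` B).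
Proof. by move=> mB; rewrite -[X in measurable X]setTI; exact: mZ. Qed.

(** The charge B |-> integral of f over {Z in B} is dominated by the law of Z. Its Radon-Nikodym
    derivative is finite, so [fine] turns it into a real-valued version. *)
Lemma is_condE_exists f : integrableR P f -> exists h, is_condE P Z f h.
Proof.
move=> iF; pose X : {mfun T >-> U} :=
  HB.pack Z (isMeasurableFun.Build _ _ _ _ Z mZ).
have [nu nuE] : exists nu : {charge set U -> \bar R},
    forall B, nu B = (\int[P]_(w in Z @^-1` B) (f w)%:E)%E.
  by exists (measure_function_pushforward__canonical__charge_Charge (induced_charge iF) mZ).
have dom : nu `<< distribution P X.
  apply/null_content_dominatesP => B mB PB0; rewrite nuE.
  apply: null_set_integral => //; first exact: measurable_preimage.
  by apply: measurable_funTS; exact: measurable_int iF.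
have fin_h := Radon_Nikodym_fin_num _ dom.
have int_h := Radon_Nikodym_integrable dom.
set h := Radon_Nikodym nu (distribution P X) in fin_h int_h.
have hE : EFin \o (fine \o h) = h by apply/funext => x /=; rewrite fineK.
have mh : measurable_fun setT h by exact: measurable_int int_h.
have iZ : P.-integrable setT (h \o Z).
  apply/integrableP; split; first exact: measurableT_comp.
  move/integrableP : int_h => [_]; apply: le_lt_trans.
  rewrite (@ge0_integral_distribution _ _ _ _ _ P X)//; exact: measurableT_comp.
exists (fine \o h); split.
- exact: measurableT_comp.
- by rewrite (_ : EFin \o _ = h \o Z)// -[in RHS]hE.
- move=> B mB; rewrite -nuE (Radon_Nikodym_integral dom)//.
  rewrite -/h (integral_pushforward mZ).
  - by apply: eq_integral => w _ /=; rewrite fineK.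
  - exact: mh.
  - by apply: (integrableS measurableT) => //; exact: measurable_preimage.
  - exact: mB.
Qed.

Section pull_out.
Variable g : T -> R.
Hypotheses (ig : integrableR P g)
  (g0 : forall B, measurable B -> \int[P]_(w in Z @^-1` B) g w = 0).

Import HBNNSimple.

Let pull_out_nnsfun (s : {nnsfun U >-> R}) : \int[P]_w (s (Z w) * g w) = 0.
Proof.
have sE w : s (Z w) * g w = \sum_(y <- finmap.enum_fset (fset_set (range s)))
    (y * (g \_ (Z @^-1` (s @^-1` [set y]))) w).
  rewrite {1}fimfunE fsbig_finite//= mulr_suml; apply: eq_bigr => y _.
  rewrite -mulrA; congr (_ * _); rewrite patchE indicE/=.
have -> : (w \in Z @^-1` (s @^-1` [set y])) = (Z w \in s @^-1` [set y]) by [].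
  by case: ifP => _; rewrite ?mul1r ?mul0r.
under eq_Rintegral do rewrite sE.
have ir (y : R) : integrableR P (g \_ (Z @^-1` (s @^-1` [set y]))).
  have mB : measurable (Z @^-1` (s @^-1` [set y])) by exact: measurable_preimage.
  rewrite /integrableR -restrict_EFin; apply/(integrable_mkcond _ mB).
  by apply: (integrableS measurableT).
rewrite Rintegral_sum; last by move=> y; exact: integrableRZ.
apply: big1_seq => y _; rewrite RintegralZl//; last exact: ir.
by rewrite -Rintegral_mkcond g0 ?mulr0.
Qed.

Let pull_out_ge0 u : measurable_fun setT u -> (forall x, 0 <= u x) ->
  integrableR P (fun w => u (Z w) * g w) -> \int[P]_w (u (Z w) * g w) = 0.
Proof.
move=> mu u0 iug; have mu' : measurable_fun setT (EFin \o u).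
  exact/measurable_EFinP.
pose s := nnsfun_approx measurableT mu'.
have : \int[P]_w (s n (Z w) * g w) @[n --> \oo] --> \int[P]_w (u (Z w) * g w).
  apply: (dominated_convergenceR (g := fun w => `|u (Z w) * g w|)).
  - move=> n; apply: measurable_funM; last exact: integrableR_measurable ig.
    by apply: measurableT_comp.
  - exact: integrableR_measurable iug.
  - apply: aeW => w; apply: cvgMl.
    have /fine_cvgP[_] // := @cvg_nnsfun_approx _ _ _ _ measurableT _ mu'
      (fun x _ => u0 x) (Z w) I.
  - exact: integrable_norm.
  - move=> n w; rewrite !normrM ler_wpM2r// ger0_norm// ger0_norm//.
    have := @le_approx _ _ _ setT (EFin \o u) n (Z w) (fun x _ => u0 x) I.
    by rewrite -lee_fin /s nnsfun_approxE.
under eq_fun do rewrite pull_out_nnsfun.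
by move=> /(cvg_unique _ (cvg_cst (0 : R))) <-.
Qed.

(** Used with [g] = f - h(Z), this is the pull-out property of conditional expectations. Simple [u]
    reduce to [g0]; simple approximations from below keep the product dominated by |u(Z) g|, so [u]
    may be unbounded; signs are handled by positive and negative parts. *)
Lemma pull_out0 u : measurable_fun setT u ->
  integrableR P (fun w => u (Z w) * g w) -> \int[P]_w (u (Z w) * g w) = 0.
Proof.
move=> mu iug.
pose up x : R := Num.max (u x) 0; pose un x : R := Num.max (- u x) 0.
have mup : measurable_fun setT up by exact: measurable_maxr.
have mun : measurable_fun setT un.
  by apply: measurable_maxr => //; exact: measurableT_comp.
have ib (v : U -> R) : measurable_fun setT v -> (forall x, `|v x| <= `|u x|) ->
    integrableR P (fun w => v (Z w) * g w).
  move=> mv vu; apply: integrableR_le (integrable_norm iug).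
    apply: measurable_funM; last exact: integrableR_measurable ig.
    exact: measurableT_comp.
  by move=> w /=; rewrite !normrM ler_wpM2r.
have iup : integrableR P (fun w => up (Z w) * g w).
  apply: ib => // x; rewrite /up; case: (leP (u x) 0) => h; last by [].
  by rewrite normr0.
have iun : integrableR P (fun w => un (Z w) * g w).
  apply: ib => // x; rewrite /un; case: (leP (- u x) 0) => h.
    by rewrite normr0.
  by rewrite normrN.
transitivity (\int[P]_w (up (Z w) * g w - un (Z w) * g w)).
  apply: eq_Rintegral => w _; rewrite -mulrBl; congr (_ * _).
  rewrite /up /un; case: (leP (u (Z w)) 0) => h; case: (leP (- u (Z w)) 0) => h'; lra.
rewrite RintegralB// !pull_out_ge0 ?subr0//.
- by move=> x; rewrite le_max lexx orbT.
- by move=> x; rewrite le_max lexx orbT.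
Qed.

End pull_out.
End conditional_expectation.

(** * Conditional expectation as an L2 contraction and an orthogonal projection *)

Section conditional_expectation_L2.
Context d d' (T : measurableType d) (U : measurableType d') (R : realType).
Variables (P : probability T R) (Z : T -> U).
Hypothesis mZ : measurable_fun setT Z.
Implicit Types (f g : T -> R) (h u : U -> R).

Lemma bounded_integrableR (M : R) f : measurable_fun setT f ->
  (forall w, `|f w| <= M) -> integrableR P f.
Proof.
move=> mf fM; apply: integrableR_le fM _ => //.
exact: (finite_measure_integrable_cst P M measurableT).
Qed.

Lemma bounded_square_integrable (M : R) f : measurable_fun setT f ->
  (forall w, `|f w| <= M) -> square_integrable P f.
Proof.
move=> mf fM; split => //; apply: (@bounded_integrableR (M ^+ 2)).
  exact: measurable_funX.
by move=> w; rewrite normrX lerXn2r// nnegrE// (le_trans _ (fM w)).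
Qed.

Lemma square_integrable_integrable f : square_integrable P f -> integrableR P f.
Proof.
move=> sf; have := square_integrableM sf (@bounded_square_integrable 1 (fun=> 1) _ _).
move=> /(_ (measurable_cst _)) h.
by apply: integrableR_eq (h _) => w; rewrite ?mulr1 ?normr1.
Qed.

(** Serves where integrability of the limit is itself in question, so that no dominating function is
    at hand: a uniform bound on the integrals passes to the limit. *)
Lemma fatouR (v_ : nat -> T -> R) (v : T -> R) (C : R) :
  (forall n, measurable_fun setT (v_ n)) -> (forall n w, 0 <= v_ n w) ->
  (forall w, v_ n w @[n --> \oo] --> v w) -> measurable_fun setT v ->
  (forall n, integrableR P (v_ n) /\ \int[P]_w v_ n w <= C) ->
  integrableR P v /\ \int[P]_w v w <= C.
Proof.
move=> mv_ v_0 v_v mv v_C.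
have v0 w : 0 <= v w.
  rewrite -(cvg_lim (@Rhausdorff R) (v_v w)).
  by apply: limr_ge; [exact: cvgP (v_v w)|exact: nearW].
suff h : (\int[P]_w (v w)%:E <= C%:E)%E.
  have iv : integrableR P v.
    apply/integrableP; split; first exact/measurable_EFinP.
    under eq_integral do rewrite /= ger0_norm ?v0//.
    by rewrite (le_lt_trans h) ?ltry.
  by split=> //; rewrite -lee_fin /Rintegral fineK ?integrable_fin_num.
have -> : (\int[P]_w (v w)%:E =
    \int[P]_w limn_einf (fun n => (v_ n w)%:E))%E.
  apply: eq_integral => w _.
  have /cvg_limn_einf_sup[-> _]// : (v_ n w)%:E @[n --> \oo] --> (v w)%:E.
  by apply/fine_cvgP; split; [exact: nearW|exact: v_v].
apply: le_trans (fatou P measurableT _ _) _.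
- by move=> n; exact/measurable_EFinP.
- by move=> n w _; rewrite lee_fin.
rewrite limn_einf_lim; apply: lime_le; first exact: is_cvg_einfs.
apply: nearW => n.
apply: le_trans (_ : _ <= \int[P]_w (v_ n w)%:E)%E _.
  by apply: ereal_inf_lbound; exists n => //=.
have [iv hC] := v_C n.
by rewrite -[leLHS]fineK ?integrable_fin_num// lee_fin.
Qed.

Lemma is_condE_Rintegral f h B : is_condE P Z f h -> measurable B ->
  \int[P]_(w in Z @^-1` B) f w = \int[P]_(w in Z @^-1` B) h (Z w).
Proof. by move=> [_ _ fh] mB; rewrite /Rintegral fh. Qed.

Lemma is_condE_mean f h : is_condE P Z f h -> \int[P]_w f w = \int[P]_w h (Z w).
Proof. by move=> /is_condE_Rintegral/(_ measurableT). Qed.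

Lemma is_condE_pull_out f h u : integrableR P f -> is_condE P Z f h ->
  measurable_fun setT u -> integrableR P (fun w => u (Z w) * f w) ->
  integrableR P (fun w => u (Z w) * h (Z w)) ->
  \int[P]_w (u (Z w) * f w) = \int[P]_w (u (Z w) * h (Z w)).
Proof.
move=> iF cE mu iuf iuh; have [mh ih _] := cE.
apply/eqP; rewrite -subr_eq0 -RintegralB//.
under eq_Rintegral do rewrite -mulrBr.
apply/eqP; apply: (@pull_out0 _ _ _ _ _ P Z mZ (fun w => f w - h (Z w))) => //.
- exact: integrableRB.
- move=> B mB; have mZB : measurable (Z @^-1` B).
    by rewrite -[X in measurable X]setTI; exact: mZ.
  rewrite RintegralB//; first by rewrite (is_condE_Rintegral cE) ?subrr.
  + by apply: (integrableS measurableT).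
  + by apply: (integrableS measurableT).
- by apply: integrableR_eq (integrableRB iuf iuh) => w; rewrite mulrBr.
Qed.

Lemma is_condEB f f' h h' : integrableR P f -> integrableR P f' ->
  is_condE P Z f h -> is_condE P Z f' h' ->
  is_condE P Z (fun w => f w - f' w) (fun z => h z - h' z).
Proof.
move=> iF iF' [mh ih fh] [mh' ih' fh']; split.
- exact: measurable_funB.
- exact: (integrableRB ih ih').
move=> B mB; have mZB : measurable (Z @^-1` B).
  by rewrite -[X in measurable X]setTI; exact: mZ.
have iS g : integrableR P g -> P.-integrable (Z @^-1` B) (EFin \o g).
  by apply: (integrableS measurableT).
rewrite [LHS](integralB_EFin mZB (iS _ iF) (iS _ iF')).
by rewrite [RHS](integralB_EFin mZB (iS _ ih) (iS _ ih')) fh// fh'.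
Qed.

(* The truncations of [h] are tested against [f]: this avoids a conditional
   Jensen inequality. *)
Lemma is_condE_square_integrable f h : square_integrable P f -> is_condE P Z f h ->
  square_integrable P (h \o Z) /\ \int[P]_w (h (Z w) ^+ 2) <= \int[P]_w (f w ^+ 2).
Proof.
move=> sf cE; have [mh ih _] := cE.
have mhZ : measurable_fun setT (h \o Z) by exact: measurableT_comp.
pose t n z := if `|h z| <= n%:R then h z else 0.
have mt n : measurable_fun setT (t n).
  apply: measurable_fun_ifT => //.
  by apply: measurable_fun_ler => //; exact: measurableT_comp.
have tb n z : `|t n z| <= n%:R by rewrite /t; case: ifP => // _; rewrite normr0.
have th n z : t n z * h z = t n z ^+ 2.
  by rewrite /t; case: ifP => _; rewrite ?expr2 ?mul0r.
have st n : square_integrable P (t n \o Z).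
  by apply: (@bounded_square_integrable n%:R) => [|w /=]; first exact: measurableT_comp.
suff [? ?] : integrableR P (fun w => h (Z w) ^+ 2) /\
    \int[P]_w (h (Z w) ^+ 2) <= \int[P]_w (f w ^+ 2) by [].
apply: (@fatouR (fun n w => t n (Z w) ^+ 2)).
- by move=> n; apply: measurable_funX; exact: measurableT_comp.
- by move=> n w; rewrite sqr_ge0.
- move=> w; apply: cvg_near_cst.
  near=> n; rewrite /t ifT//; near: n; exact: nbhs_infty_ger.
- exact: measurable_funX.
move=> n; have [_ st2] := st n; split => //.
have [_ sf2] := sf.
have itf := square_integrableM (st n) sf.
have E : \int[P]_w (t n (Z w) * f w) = \int[P]_w (t n (Z w) ^+ 2).
  rewrite (is_condE_pull_out _ cE)//; first by apply: eq_Rintegral => w _.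
  - exact: square_integrable_integrable.
  - by apply: integrableR_eq st2 => w /=; rewrite th.
(* By [E] the left side is the integral of t_n(Z)^2, finite because of the truncation. Half of it
   can therefore be absorbed, which leaves the integral of f^2 as a bound uniform in n. *)
have : \int[P]_w (t n (Z w) * f w) <=
    2^-1 * \int[P]_w (t n (Z w) ^+ 2) + 2^-1 * \int[P]_w (f w ^+ 2).
  rewrite -!RintegralZl// -RintegralD//; [|exact: integrableRZ..].
  apply: le_Rintegral => //; first by apply: integrableRD; exact: integrableRZ.
  by move=> w _; have := sqr_ge0 (t n (Z w) - f w); lra.
by rewrite E; lra.
Unshelve. all: by end_near. Qed.

(** Gives access to the version picked by [xget]; the properties of [condE1] below are all derived
    through it. *)
Lemma condE1P f : integrableR P f ->
  exists2 h, is_condE P Z f h & condE1 P Z f = h \o Z.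
Proof.
move=> /(is_condE_exists mZ)[h hE].
by exists (xget (cst 0) (is_condE P Z f)) => //; exact: (xgetPex _ (ex_intro _ h hE)).
Qed.

Lemma condE1_square_integrable f : square_integrable P f ->
  square_integrable P (condE1 P Z f).
Proof.
move=> sf; have [h hE ->] := condE1P (square_integrable_integrable sf).
by have [] := is_condE_square_integrable sf hE.
Qed.

Lemma condE1_mean f : integrableR P f ->
  \int[P]_w condE1 P Z f w = \int[P]_w f w.
Proof. by move=> /condE1P[h /is_condE_mean -> ->]. Qed.

Lemma condE1_orth f u : square_integrable P f -> measurable_fun setT u ->
  square_integrable P (u \o Z) ->
  \int[P]_w ((f w - condE1 P Z f w) * u (Z w)) = 0.
Proof.
move=> sf mu su; have iF := square_integrable_integrable sf.
have [h hE ->] := condE1P iF.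
have [sh _] := is_condE_square_integrable sf hE.
have iuf := square_integrableM su sf; have iuh := square_integrableM su sh.
transitivity (\int[P]_w (u (Z w) * f w - u (Z w) * h (Z w))).
  by apply: eq_Rintegral => w _ /=; ring.
by rewrite RintegralB// (is_condE_pull_out _ hE)// subrr.
Qed.

(** The contraction property applied to f - f'. The second version is arbitrary, so that an explicit
    formula such as [cond_mean] can be compared with the version chosen by [condE1]. *)
Lemma condE1_dist f f' h' : square_integrable P f -> square_integrable P f' ->
  is_condE P Z f' h' ->
  \int[P]_w ((condE1 P Z f w - h' (Z w)) ^+ 2) <= \int[P]_w ((f w - f' w) ^+ 2).
Proof.
move=> sf sf' hE'; have iF := square_integrable_integrable sf.
have iF' := square_integrable_integrable sf'.
have [h hE ->] := condE1P iF.
have := is_condE_square_integrable (square_integrableB sf sf')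
  (is_condEB iF iF' hE hE').
by case.
Qed.

End conditional_expectation_L2.

(** * Densities *)

Section density.
Context d (T : measurableType d) (R : realType).
Variables (m : {measure set T -> \bar R}) (P : probability T R).
Variable p : T -> R.
Hypotheses (mp : measurable_fun setT p) (p0 : forall w, 0 <= p w).
Hypothesis Pp : forall A, measurable A -> P A = (\int[m]_(w in A) (p w)%:E)%E.

Lemma density_integrable : integrableR m p.
Proof.
apply/integrableP; split; first exact/measurable_EFinP.
under eq_integral do rewrite /= ger0_norm ?p0//.
by rewrite -Pp// probability_setT ltry.
Qed.

Lemma density_dominates : P `<< m.
Proof.
apply/null_content_dominatesP => A mA mA0; rewrite /= Pp//.
by apply: null_set_integral => //; apply: measurable_funTS; exact/measurable_EFinP.
Qed.

Import HBNNSimple.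

Let density_nnsfun (s : {nnsfun T >-> R}) :
  (\int[P]_w (s w)%:E = \int[m]_w (s w * p w)%:E)%E.
Proof.
pose D y := s @^-1` [set y].
have mD y : measurable (D y).
  by apply: measurable_funPTI; exact: measurable_set1.
have sE w : s w = \sum_(y <- finmap.enum_fset (fset_set (range s)))
    (y * \1_(D y) w).
  by rewrite {1}fimfunE fsbig_finite.
have i1 y : integrableR P (\1_(D y) : T -> R).
  exact: (integrable_indic P (mD y)).
have ip y : integrableR m (fun w => \1_(D y) w * p w).
  apply: integrableR_le density_integrable.
    by apply: measurable_funM => //; exact: measurable_indic.
  by move=> w; rewrite normrM (ger0_norm (p0 w)) ler_piMl// indicE; case: (_ \in _);
    rewrite ?normr1 ?normr0.
have ints : integrableR P s.
  apply: integrableR_eq (_ : integrableR P (fun w =>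
      \sum_(y <- finmap.enum_fset (fset_set (range s))) (y * \1_(D y) w))).
    by move=> w; rewrite -sE.
  by apply: integrableR_sum => y; exact: integrableRZ.
have isp : integrableR m (fun w => s w * p w).
  apply: integrableR_eq (_ : integrableR m (fun w =>
      \sum_(y <- finmap.enum_fset (fset_set (range s))) (y * (\1_(D y) w * p w)))).
    by move=> w; rewrite [in RHS]sE mulr_suml; apply: eq_bigr => y _; rewrite mulrA.
  by apply: integrableR_sum => y; exact: integrableRZ.
rewrite -[LHS]fineK ?integrable_fin_num//.
rewrite -[RHS]fineK ?integrable_fin_num//; congr EFin.
rewrite -/(Rintegral P setT s) -/(Rintegral m setT (fun w => s w * p w)).
transitivity (\int[P]_w (\sum_(y <- finmap.enum_fset (fset_set (range s)))
    (y * \1_(D y) w))); first by apply: eq_Rintegral => w _; rewrite -sE.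
transitivity (\int[m]_w (\sum_(y <- finmap.enum_fset (fset_set (range s)))
    (y * (\1_(D y) w * p w)))); last first.
  apply: eq_Rintegral => w _; rewrite [in RHS]sE mulr_suml.
  by apply: eq_bigr => y _; rewrite mulrA.
rewrite !Rintegral_sum; try by move=> y; exact: integrableRZ.
apply: eq_bigr => y _; rewrite RintegralZl//; last exact: i1.
rewrite RintegralZl//; last exact: ip.
congr (_ * fine _); rewrite integral_indic// setIT; apply: (etrans (Pp (mD y))).
rewrite integral_mkcond.
apply: eq_integral => w _; rewrite patchE indicE.
by case: ifP => _; rewrite (mul1r, mul0r).
Qed.

(** Monotone convergence under P and under m reduces the change of measure to simple functions. *)
Lemma density_ge0_integral (f : T -> \bar R) : measurable_fun setT f ->
  (forall w, 0 <= f w)%E -> (\int[P]_w f w = \int[m]_w (f w * (p w)%:E))%E.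
Proof.
move=> mf f0; pose s := nnsfun_approx measurableT mf.
have sf w : (s n w)%:E @[n --> \oo] --> f w.
  exact: (cvg_nnsfun_approx measurableT mf (fun x _ => f0 x)).
have s_le w : {homo (fun n => s n w) : a b / (a <= b)%N >-> a <= b}.
  by move=> a c ac; exact/lefP/nd_nnsfun_approx.
have h1 : (\int[P]_w (s n w)%:E)%E @[n --> \oo] --> (\int[P]_w f w)%E.
  rewrite (_ : f = fun w => limn (fun n => (s n w)%:E)); last first.
    by apply/funext => w; apply/esym/cvg_lim.
  apply: cvg_monotone_convergence => //.
  - by move=> n; exact/measurable_EFinP.
  - by move=> n w _; rewrite lee_fin.
  - by move=> w _ a c ac; rewrite lee_fin s_le.
have h2 : (\int[m]_w (s n w * p w)%:E)%E @[n --> \oo] --> (\int[m]_w (f w * (p w)%:E))%E.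
  rewrite (_ : (fun w => (f w * (p w)%:E)%E) =
    fun w => limn (fun n => (s n w * p w)%:E)); last first.
    apply/funext => w; apply/esym/cvg_lim => //.
    by under eq_fun do rewrite EFinM; apply: cvgeZr => //; exact: sf.
  apply: cvg_monotone_convergence => //.
  - by move=> n; apply/measurable_EFinP; exact: measurable_funM.
  - by move=> n w _; rewrite lee_fin mulr_ge0.
  - by move=> w _ a c ac; rewrite lee_fin ler_wpM2r// s_le.
have E : (fun n => \int[P]_w (s n w)%:E)%E = (fun n => \int[m]_w (s n w * p w)%:E)%E.
  by apply/funext => n; exact: density_nnsfun.
rewrite E in h1; exact: cvg_unique h1 h2.
Qed.

Lemma density_integrableP (f : T -> R) : measurable_fun setT f ->
  integrableR P f <-> integrableR m (fun w => f w * p w).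
Proof.
move=> mf; have E : (\int[P]_w `|(f w)%:E| = \int[m]_w `|(f w * p w)%:E|)%E.
  rewrite density_ge0_integral//; last first.
    by apply: measurableT_comp => //; exact/measurable_EFinP.
  by apply: eq_integral => w _; rewrite EFinM abseM (gee0_abs (x := (p w)%:E)) ?lee_fin.
split=> /integrableP [mf' iF]; apply/integrableP; split => /=.
- by apply/measurable_EFinP; exact: measurable_funM.
- by rewrite -E.
- exact/measurable_EFinP.
- by rewrite E.
Qed.

Lemma density_Rintegral (f : T -> R) : integrableR P f ->
  \int[P]_w f w = \int[m]_w (f w * p w).
Proof.
move=> iF; have mf := integrableR_measurable iF.
pose fp w := Num.max (f w) 0; pose fn w := Num.max (- f w) 0.
have mfp : measurable_fun setT fp by exact: measurable_maxr.
have mfn : measurable_fun setT fn.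
  by apply: measurable_maxr => //; exact: measurableT_comp.
have fp0 w : 0 <= fp w by rewrite le_max lexx orbT.
have fn0 w : 0 <= fn w by rewrite le_max lexx orbT.
have ifp : integrableR P fp.
  apply: integrableR_le (integrable_norm iF) => // w /=.
  by rewrite /fp; case: (leP (f w) 0) => h; rewrite ?normr0.
have ifn : integrableR P fn.
  apply: integrableR_le (integrable_norm iF) => // w /=.
  by rewrite /fn; case: (leP (- f w) 0) => h; rewrite ?normr0 ?normrN.
have fE w : f w = fp w - fn w.
  rewrite /fp /fn; case: (leP (f w) 0); case: (leP (- f w) 0) => ? ?; lra.
have key (g : T -> R) : measurable_fun setT g -> (forall w, 0 <= g w) ->
    \int[P]_w g w = \int[m]_w (g w * p w).
  move=> mg g0; congr fine; rewrite density_ge0_integral//.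
  exact/measurable_EFinP.
transitivity (\int[P]_w (fp w - fn w)); first exact: eq_Rintegral.
rewrite RintegralB// !key//.
rewrite -RintegralB//; [|exact/density_integrableP..].
by apply: eq_Rintegral => w _; rewrite fE mulrBl.
Qed.

End density.

Lemma dotvE (R : realType) n (u v : 'cV[R]_n) : dotv u v = \sum_i u i 0 * v i 0.
Proof. by rewrite /dotv mxE; apply: eq_bigr => i _; rewrite mxE. Qed.

Lemma measurable_dotv d (T : measurableType d) (R : realType) n
    (c : 'cV[R]_n) (s : T -> 'cV[R]_n) :
  (forall i, measurable_fun setT (fun w => s w i 0)) ->
  measurable_fun setT (fun w => dotv c (s w)).
Proof.
move=> ms; under eq_fun do rewrite dotvE.
by apply: measurable_sum => i; exact: measurable_funM.
Qed.

(** For nonnegative values the inverse is the real power with exponent -1, a measurable function;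
    this includes the convention at 0. *)
Lemma measurable_funV d (T : measurableType d) (R : realType) (f : T -> R) :
  (forall x, 0 <= f x) -> measurable_fun setT f ->
  measurable_fun setT (fun x => (f x)^-1).
Proof.
move=> f0 mf; under eq_fun do rewrite -powR_inv1//.
exact: (@measurableT_comp _ _ _ _ _ _ (@powR R ^~ (-1))).
Qed.

(** * The normaliser, tilted means and the marginal law of X *)

Section model.
Context (R : realType) (q : nat).
Variables (nu : {sigma_finite_measure set R -> \bar R})
  (mu : {sigma_finite_measure set (q.-tuple R) -> \bar R}).
Variable b : 'cV[R]_q.
Implicit Types (g s : R -> R) (eta : q.-tuple R -> R).

Let tilt (yx : R * q.-tuple R) := expR (dotv b (vec_of_tuple yx.2) * yx.1).

Lemma measurable_tilt : measurable_fun setT tilt.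
Proof.
apply: measurableT_comp => //; apply: measurable_funM => //.
apply: (measurable_dotv b (s := fun yx => vec_of_tuple yx.2)) => i.
under eq_fun do rewrite mxE.
by apply: (measurableT_comp (f := fun x : q.-tuple R => tnth x i)) => //;
  exact: measurable_tnth.
Qed.

Lemma measurable_plr_norm g : measurable_fun setT g -> (forall y, 0 <= g y) ->
  measurable_fun setT (plr_norm nu b g).
Proof.
move=> mg g0; apply: (measurable_fun_fubini_tonelli_G
  (fun yx : R * q.-tuple R => (tilt yx * g yx.1)%:E)).
- apply/measurable_EFinP; apply: measurable_funM; first exact: measurable_tilt.
  exact: measurableT_comp.
- by move=> yx; rewrite lee_fin mulr_ge0// expR_ge0.
Qed.

Lemma measurable_fine_plr_norm g : measurable_fun setT g -> (forall y, 0 <= g y) ->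
  measurable_fun setT (fun x => fine (plr_norm nu b g x)).
Proof. by move=> mg g0; apply: measurableT_comp => //; exact: measurable_plr_norm. Qed.

Lemma plr_norm_ge0 g x : (forall y, 0 <= g y) -> (0 <= plr_norm nu b g x)%E.
Proof. by move=> g0; apply: integral_ge0 => y _; rewrite lee_fin mulr_ge0// expR_ge0. Qed.

Lemma plr_dens_ge0 g eta yx : (forall y, 0 <= g y) -> (forall x, 0 <= eta x) ->
  0 <= plr_dens nu b g eta yx.
Proof.
move=> g0 e0; rewrite /plr_dens mulr_ge0// divr_ge0 ?mulr_ge0 ?expR_ge0//.
by rewrite fine_ge0// plr_norm_ge0.
Qed.

Lemma measurable_plr_dens g eta : measurable_fun setT g -> (forall y, 0 <= g y) ->
  measurable_fun setT eta -> measurable_fun setT (plr_dens nu b g eta).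
Proof.
move=> mg g0 me; apply: measurable_funM; last exact: measurableT_comp.
apply: measurable_funM.
  by apply: measurable_funM; [exact: measurable_tilt|exact: measurableT_comp].
apply: (measurable_funV (f := fun yx : R * q.-tuple R => fine (plr_norm nu b g yx.2))).
  by move=> x; rewrite fine_ge0// plr_norm_ge0.
apply: (measurableT_comp (f := fun x => fine (plr_norm nu b g x))) => //.
exact: measurable_fine_plr_norm.
Qed.

Let measurable_tilt_y g x : measurable_fun setT g ->
  measurable_fun setT (fun y => tilt (y, x) * g y).
Proof.
move=> mg; apply: measurable_funM => //.
exact: (measurable_fun_pair1 (f := tilt) x measurable_tilt).
Qed.

(** The tilt is positive everywhere, so a zero normaliser would force g = 0 almost everywhere,
    against its total mass 1. *)
Lemma plr_norm_gt0 g x : is_density nu g -> (0 < plr_norm nu b g x)%E.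
Proof.
move=> [mg g0 g1]; rewrite lt0e plr_norm_ge0// andbT; apply/eqP => N0.
have : (\int[nu]_y `|(tilt (y, x) * g y)%:E| = 0)%E.
  rewrite -[RHS]N0; apply: eq_integral => y _.
  by rewrite gee0_abs// lee_fin mulr_ge0// expR_ge0.
move=> /(ae_eq_integral_abs _ measurableT _).1 h.
have {h} : ae_eq nu setT (EFin \o g) (cst 0%E).
  apply: filterS (h _) => [y /(_ I)|]; last first.
    by apply/measurable_EFinP; exact: measurable_tilt_y.
  move=> [] /eqP; rewrite mulf_eq0 gt_eqF ?expR_gt0//= => /eqP gy _.
  by rewrite /= gy.
move=> /(ae_eq_integral_abs _ measurableT _).2 h.
move: g1; rewrite (_ : (\int[_]_x _ = \int[nu]_x `|(EFin \o g) x|)%E); last first.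
  by apply: eq_integral => y _; rewrite gee0_abs// lee_fin.
by rewrite h; [move=> /eqP; rewrite eq_sym onee_eq0|exact/measurable_EFinP].
Qed.

Lemma fine_plr_norm_gt0 g x : is_density nu g -> (plr_norm nu b g x < +oo)%E ->
  0 < fine (plr_norm nu b g x).
Proof. by move=> hg fin; rewrite fine_gt0// plr_norm_gt0. Qed.

(* E(s(Y) | X = x), for [s] nonnegative; 0 where [plr_norm] is infinite. *)
Definition tilted_mean g s x : R :=
  fine (plr_norm nu b (fun y => g y * s y) x) / fine (plr_norm nu b g x).

Lemma measurable_tilted_mean g s : measurable_fun setT g -> (forall y, 0 <= g y) ->
  measurable_fun setT s -> (forall y, 0 <= s y) ->
  measurable_fun setT (tilted_mean g s).
Proof.
move=> mg g0 ms s0; apply: measurable_funM.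
  apply: measurable_fine_plr_norm; first exact: measurable_funM.
  by move=> y; rewrite mulr_ge0.
apply: measurable_funV => [x|]; last exact: measurable_fine_plr_norm.
by rewrite fine_ge0// plr_norm_ge0.
Qed.

Lemma plr_normM_le g s M x : measurable_fun setT g -> (forall y, 0 <= g y) ->
  measurable_fun setT s -> (forall y, 0 <= s y <= M) ->
  (plr_norm nu b (fun y => (g y * s y)%R) x <= M%:E * plr_norm nu b g x)%E.
Proof.
move=> mg g0 ms sM; have M0 : 0 <= M by case/andP: (sM 0) => /le_trans h /h.
rewrite /plr_norm -ge0_integralZl_EFin//; last 2 first.
- by move=> y _; rewrite lee_fin mulr_ge0// expR_ge0.
- by apply/measurable_EFinP; exact: measurable_tilt_y.
apply: ge0_le_integral => //.
- move=> y _; rewrite lee_fin !mulr_ge0 ?expR_ge0//.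
  by case/andP: (sM y).
- by apply/measurable_EFinP; apply: measurable_tilt_y; exact: measurable_funM.
- apply/measurable_EFinP; apply: measurable_funM => //.
  exact: measurable_tilt_y.
- move=> y _; rewrite -EFinM lee_fin mulrA mulrC ler_wpM2r// ?mulr_ge0 ?expR_ge0//.
  by case/andP: (sM y).
Qed.

Lemma plr_normM_lty g s M x : measurable_fun setT g -> (forall y, 0 <= g y) ->
  measurable_fun setT s -> (forall y, 0 <= s y <= M) ->
  (plr_norm nu b g x < +oo)%E -> (plr_norm nu b (fun y => (g y * s y)%R) x < +oo)%E.
Proof.
move=> mg g0 ms sM fin; apply: le_lt_trans (plr_normM_le _ mg g0 ms sM) _.
by rewrite lte_mul_pinfty//; case/andP: (sM 0) => /le_trans h /h.
Qed.

Lemma tilted_mean_bound g s M x : is_density nu g ->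
  measurable_fun setT s -> (forall y, 0 <= s y <= M) ->
  0 <= tilted_mean g s x <= M.
Proof.
move=> hg ms sM; have [mg g0 _] := hg.
have M0 : 0 <= M by case/andP: (sM 0) => /le_trans h /h.
have gs0 y : 0 <= g y * s y by rewrite mulr_ge0//; case/andP: (sM y).
rewrite /tilted_mean divr_ge0 ?fine_ge0 ?plr_norm_ge0//=.
have [fin|] := ltP (plr_norm nu b g x) +oo%E; last first.
  by rewrite leye_eq => /eqP ->; rewrite invr0 mulr0.
rewrite ler_pdivrMr ?fine_plr_norm_gt0// -lee_fin.
have f1 : plr_norm nu b g x \is a fin_num by rewrite ge0_fin_numE ?plr_norm_ge0.
rewrite EFinM !fineK//; first exact: plr_normM_le.
by rewrite ge0_fin_numE ?plr_norm_ge0//; exact: plr_normM_lty fin.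
Qed.

Lemma integral_plr_dens_y g eta s M x : is_density nu g ->
  measurable_fun setT s -> (forall y, 0 <= s y <= M) ->
  (forall x, 0 <= eta x) -> (0 < eta x -> (plr_norm nu b g x < +oo)%E) ->
  (\int[nu]_y (s y * plr_dens nu b g eta (y, x))%:E =
    (tilted_mean g s x * eta x)%:E)%E.
Proof.
move=> hg ms sM e0 fin; have [mg g0 _] := hg.
have gs0 y : 0 <= g y * s y by rewrite mulr_ge0//; case/andP: (sM y).
have mgs : measurable_fun setT (fun y => g y * s y) by exact: measurable_funM.
(* Where [eta] vanishes the normaliser may be infinite, but both sides are 0. *)
have [ex0|ex0] := eqVneq (eta x) 0.
  rewrite ex0 mulr0; apply: integral0_eq => y _.
  by rewrite /plr_dens ex0 !mulr0.
have {}fin : (plr_norm nu b g x < +oo)%E by apply: fin; rewrite lt_def ex0 e0.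
rewrite (eq_integral (fun y => ((eta x / fine (plr_norm nu b g x))%:E *
    (tilt (y, x) * (g y * s y))%:E)%E)); last first.
  by move=> y _; rewrite -EFinM /plr_dens/=; congr EFin; rewrite /tilt/=; ring.
rewrite ge0_integralZl_EFin//; last 3 first.
- by move=> y _; rewrite lee_fin mulr_ge0// expR_ge0.
- by apply/measurable_EFinP; exact: measurable_tilt_y.
- by rewrite divr_ge0// fine_ge0// plr_norm_ge0.
rewrite -/(plr_norm nu b (fun y => g y * s y) x).
rewrite -[X in (_ * X)%E]fineK; last first.
  by rewrite ge0_fin_numE ?plr_norm_ge0//; exact: plr_normM_lty fin.
by rewrite -EFinM /tilted_mean; congr EFin; ring.
Qed.

Lemma tilted_mean1 g x : is_density nu g -> (plr_norm nu b g x < +oo)%E ->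
  tilted_mean g (fun=> 1) x = 1.
Proof.
move=> hg fin; rewrite /tilted_mean.
under [X in plr_norm nu b X]eq_fun do rewrite mulr1.
by rewrite divff// gt_eqF// fine_plr_norm_gt0.
Qed.

(** Tonelli, integrating out y first: the fibre over x contributes the tilted mean of [s] times
    [eta]. The weight [u] will carry the indicators that define E(s(Y) | X). *)
Lemma integral_plr_dens g eta s M (u : q.-tuple R -> \bar R) :
  plr_model nu mu b g eta ->
  measurable_fun setT s -> (forall y, 0 <= s y <= M) ->
  measurable_fun setT u -> (forall x, 0 <= u x)%E ->
  (\int[nu \x mu]_z (u z.2 * (s z.1 * plr_dens nu b g eta z)%:E) =
   \int[mu]_x (u x * (tilted_mean g s x * eta x)%:E))%E.
Proof.
move=> [hg [me e0 _] fin] ms sM mu_ u0; have [mg g0 _] := hg.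
have s0 y : 0 <= s y by case/andP: (sM y).
have mp : measurable_fun setT (fun z => s z.1 * plr_dens nu b g eta z).
  by apply: measurable_funM; [exact: measurableT_comp|exact: measurable_plr_dens].
rewrite fubini_tonelli2//=; first last.
- by move=> z; rewrite mule_ge0// lee_fin mulr_ge0// plr_dens_ge0.
- by apply: emeasurable_funM; [exact: measurableT_comp|exact/measurable_EFinP].
apply: ae_eq_integral => //.
- apply: (measurable_fun_fubini_tonelli_G (fun z : R * q.-tuple R =>
    (u z.2 * (s z.1 * plr_dens nu b g eta z)%:E)%E)).
    by apply: emeasurable_funM; [exact: measurableT_comp|exact/measurable_EFinP].
  by move=> z; rewrite mule_ge0// lee_fin mulr_ge0// plr_dens_ge0.
- apply: emeasurable_funM => //; apply/measurable_EFinP.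
  by apply: measurable_funM => //; exact: measurable_tilted_mean.
apply: filterS fin => x fin _; rewrite /fubini_G/= ge0_integralZl//; last 2 first.
- by apply/measurable_EFinP; exact: (measurable_fun_pair1 x mp).
- by move=> y _; rewrite lee_fin mulr_ge0// plr_dens_ge0.
by rewrite (integral_plr_dens_y hg ms sM).
Qed.

(** With s = 1 the tilted mean is 1 wherever [eta] is positive and the normaliser finite. Hence the
    law of X has density [eta], and no trace of [g] or [b] remains. *)
Lemma plr_dens_marginal g eta (u : q.-tuple R -> \bar R) :
  plr_model nu mu b g eta -> measurable_fun setT u -> (forall x, 0 <= u x)%E ->
  (\int[nu \x mu]_z (u z.2 * (plr_dens nu b g eta z)%:E) =
   \int[mu]_x (u x * (eta x)%:E))%E.
Proof.
move=> hm mu_ u0; have [hg [me e0 _] fin] := hm; have [mg g0 _] := hg.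
have h01 (y : R) : 0 <= (1 : R) <= 1 by rewrite ler01 lexx.
have := integral_plr_dens hm (measurable_cst (1 : R)) h01 mu_ u0.
under eq_integral do rewrite mul1r.
move=> ->; apply: ae_eq_integral => //.
- apply: emeasurable_funM => //; apply/measurable_EFinP.
  by apply: measurable_funM => //; exact: measurable_tilted_mean.
- by apply: emeasurable_funM => //; exact/measurable_EFinP.
apply: filterS fin => x fin _; have [->|ex0] := eqVneq (eta x) 0.
  by rewrite mulr0.
by rewrite tilted_mean1 ?mul1r//; apply: fin; rewrite lt_def ex0 e0.
Qed.

End model.

(** * Scores of parametric families *)

Section elementary_bounds.
Context (R : realType).

(** The error factors as (x - y) times ((1 - xy) + (1 - y^2)) / (2y). Both factors are of first
    order in |x^2 - 1| + |y^2 - 1|, so their product is of second order. Dividing by x + y >= 1 and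
    by 1 + xy >= 1 reduces them to differences of squares. *)
Let ratio_bound (x y : R) : 2^-1 <= x -> 2^-1 <= y -> `|y ^+ 2 - 1| <= 2^-1 ->
  `|x / y - 1 - 2^-1 * (x ^+ 2 - y ^+ 2)| <=
    3 * (`|x ^+ 2 - 1| + `|y ^+ 2 - 1|) ^+ 2.
Proof.
move=> xh yh ch.
have x0 : 0 <= x by lra.
have y0 : 0 <= y by lra.
have yn0 : y != 0 by rewrite gt_eqF//; lra.
have -> : x / y - 1 - 2^-1 * (x ^+ 2 - y ^+ 2) =
    (x - y) * ((2 * y)^-1 * ((1 - x * y) + (1 - y ^+ 2))).
  by field.
rewrite normrM.
have a0 : 0 <= `|x ^+ 2 - 1| by [].
have c0 : 0 <= `|y ^+ 2 - 1| by [].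
have B1 : `|x - y| <= `|x ^+ 2 - 1| + `|y ^+ 2 - 1|.
  have : `|x - y| * (x + y) <= `|x ^+ 2 - 1| + `|y ^+ 2 - 1|.
    rewrite -[X in _ * X]ger0_norm ?addr_ge0// -normrM.
    have -> : (x - y) * (x + y) = (x ^+ 2 - 1) - (y ^+ 2 - 1) by ring.
    exact: ler_normB.
  have : 0 <= `|x - y| by []. nra.
have B2 : `|1 - x * y| <= `|x ^+ 2 - 1| + `|y ^+ 2 - 1| + `|x ^+ 2 - 1| * `|y ^+ 2 - 1|.
  have : `|1 - x * y| * (1 + x * y) <=
      `|x ^+ 2 - 1| + `|y ^+ 2 - 1| + `|x ^+ 2 - 1| * `|y ^+ 2 - 1|.
    rewrite -[X in _ * X <= _]ger0_norm; last by rewrite addr_ge0// mulr_ge0.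
    rewrite -normrM.
    have -> : (1 - x * y) * (1 + x * y) =
      - ((x ^+ 2 - 1) + (y ^+ 2 - 1)) - (x ^+ 2 - 1) * (y ^+ 2 - 1) by ring.
    rewrite (le_trans (ler_normB _ _))// normrM lerD2r normrN; exact: ler_normD.
  have : 0 <= `|1 - x * y| by []. have := mulr_ge0 x0 y0; nra.
(* Here (2y)^-1 <= 1. With a = |x^2 - 1| and c = |y^2 - 1| <= 1/2, the remaining factor is at most a
   + 2c + ac <= 2a + 2c; the constant 3 leaves room. *)
have B3 : `|(2 * y)^-1 * (1 - x * y + (1 - y ^+ 2))| <=
    3 * (`|x ^+ 2 - 1| + `|y ^+ 2 - 1|).
  rewrite normrM -[X in _ <= X]mul1r; apply: ler_pM => //.
    rewrite normfV invf_le1 ?normr_gt0 ?mulf_neq0//; first rewrite ger0_norm; lra.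
  apply: (le_trans (ler_normD _ _)).
  rewrite [`|1 - y ^+ 2|]distrC.
  have : `|x ^+ 2 - 1| * `|y ^+ 2 - 1| <= `|x ^+ 2 - 1|.
    by rewrite ler_piMr//; lra.
  lra.
rewrite expr2 mulrA [3 * _]mulrC -mulrA; exact: ler_pM.
Qed.

(** The previous bound at x = sqrt(1 + u), y = sqrt(1 + v). The linear part (u - v)/2 will be half
    the score, and the quadratic remainder is what differentiability in quadratic mean requires. *)
Lemma sqrt_ratio_bound (u v : R) : `|u| <= 2^-1 -> `|v| <= 2^-1 ->
  `|Num.sqrt ((1 + u) / (1 + v)) - 1 - 2^-1 * (u - v)| <= 3 * (`|u| + `|v|) ^+ 2.
Proof.
move=> uh vh; have /andP[u1 u2] : - 2^-1 <= u <= 2^-1 by rewrite -ler_norml.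
have /andP[v1 v2] : - 2^-1 <= v <= 2^-1 by rewrite -ler_norml.
have u0 : 0 <= 1 + u by lra.
have v0 : 0 <= 1 + v by lra.
have h (w : R) : - 2^-1 <= w -> 2^-1 <= Num.sqrt (1 + w).
  move=> wh; have w2 : Num.sqrt (1 + w) ^+ 2 = 1 + w by rewrite sqr_sqrtr//; lra.
  by have := sqrtr_ge0 (1 + w); rewrite leNgt => ?; apply/negP => ?; nra.
have := @ratio_bound (Num.sqrt (1 + u)) (Num.sqrt (1 + v)) (h _ u1) (h _ v1).
rewrite !sqr_sqrtr// sqrtrM// sqrtrV//.
have E (w : R) : 1 + w - 1 = w by ring.
have e : 1 + u - (1 + v) = u - v by ring.
by rewrite !E e => /(_ vh).
Qed.

Lemma dotv_ge0 r (c : 'cV[R]_r) : 0 <= dotv c c.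
Proof. by rewrite dotvE sumr_ge0// => i _; rewrite -expr2 sqr_ge0. Qed.

Lemma dotv_bound r (c v : 'cV[R]_r) M : (forall i, `|v i 0| <= M) ->
  `|dotv c v| <= r%:R * M * Num.sqrt (dotv c c).
Proof.
move=> vM; rewrite dotvE (le_trans (ler_norm_sum _ _ _))//.
have -> : r%:R * M * Num.sqrt (dotv c c) =
    \sum_(i < r) (Num.sqrt (dotv c c) * M).
  by rewrite sumr_const card_ord -[RHS]mulr_natr; ring.
apply: ler_sum => i _; rewrite normrM ler_pM// -sqrtr_sqr ler_wsqrtr//.
rewrite dotvE (bigD1 i)//= -expr2 lerDl sumr_ge0// => j _.
by rewrite -expr2 sqr_ge0.
Qed.

(** With K = r M the threshold says |c|^2 (4 K^2 + 1) < 1, hence K |c| <= 1/2; the summand 1 keeps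
    it meaningful when K = 0. *)
Lemma dotv_small r (c v : 'cV[R]_r) M : 0 <= M -> (forall i, `|v i 0| <= M) ->
  dotv c c < (4 * (r%:R * M) ^+ 2 + 1)^-1 -> `|dotv c v| <= 2^-1.
Proof.
move=> M0 vM; set K := r%:R * M => h.
apply: le_trans (dotv_bound c vM) _; rewrite -/K.
have k2 : 0 < 4 * K ^+ 2 + 1 by have := sqr_ge0 K; lra.
have : dotv c c * (4 * K ^+ 2 + 1) < 1 by rewrite -ltr_pdivlMr// div1r.
have rho2 : Num.sqrt (dotv c c) ^+ 2 = dotv c c by rewrite sqr_sqrtr ?dotv_ge0.
rewrite -{1}rho2; set x := Num.sqrt _.
have -> : x ^+ 2 * (4 * K ^+ 2 + 1) = 4 * (K * x) ^+ 2 + x ^+ 2 by ring.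
have aux (y z : R) : 0 <= z -> 4 * y ^+ 2 + z < 1 -> y <= 2^-1.
  by move=> z0 yz; rewrite leNgt; apply/negP => y2; nra.
exact: (aux (K * x) (x ^+ 2) (sqr_ge0 x)).
Qed.

Lemma dotvBr r (c u v : 'cV[R]_r) : dotv c (u - v) = dotv c u - dotv c v.
Proof. by rewrite /dotv mulmxBr !mxE. Qed.

Lemma dotv_delta r (t : R) (j : 'I_r) (v : 'cV[R]_r) :
  dotv (t *: delta_mx j 0) v = t * v j 0.
Proof.
rewrite dotvE (bigD1 j)//= !mxE !eqxx mulr1 big1 ?addr0// => i ij.
by rewrite !mxE (negbTE ij) mulr0 mul0r.
Qed.

Lemma is_derive_ln_ratio (k a b : R) : 0 < k ->
  is_derive (0 : R) (1 : R) (fun t : R => ln (k * ((1 + t * a) / (1 + t * b)))) (a - b).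
Proof.
move=> k0.
have lin (c : R) : is_derive (0 : R) (1 : R) (fun t : R => ln (1 + t * c)) c.
  have h : is_derive (0 : R) (1 : R) (fun t : R => 1 + t * c) c.
    have -> : (fun t : R => 1 + t * c) = (cst 1 + c *: id)%R.
      by apply/funext => t; rewrite /= fctE/= mulrC.
    have := is_deriveD (is_derive_cst (1 : R) (0 : R) (1 : R))
      (is_deriveZ c (is_derive_id (0 : R) (1 : R))).
    rewrite add0r => /(is_derive_eq); apply; exact: mulr1.
  have l1 : is_derive (1 + 0 * c : R) (1 : R) (@ln R) (1 + 0 * c)^-1.
    by apply: is_derive1_ln; rewrite mul0r addr0.
  have := @is_derive1_comp R (@ln R) (fun t : R => 1 + t * c) 0 _ _ l1 h.
  by rewrite mul0r addr0 invr1 mul1r.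
have : is_derive (0 : R) (1 : R)
    (cst (ln k) + ((fun t : R => ln (1 + t * a)) - (fun t : R => ln (1 + t * b)))) (a - b).
  have := is_deriveD (is_derive_cst (ln k : R) (0 : R) (1 : R)) (is_deriveB (lin a) (lin b)).
  by rewrite add0r.
apply: near_eq_is_derive.
have p (c : R) : \forall t \near (0 : R), 0 < 1 + t * c.
  have : (1 + t * c) @[t --> (0 : R)] --> (1 + 0 * c).
    by apply: cvgD; [exact: cvg_cst|apply: cvgMl; exact: cvg_id].
  rewrite mul0r addr0 => /cvgr_gt; apply; exact: ltr01.
have pa := p a; have pb := p b.
near=> t.
have ta : 0 < 1 + t * a by near: t.
have tb : 0 < 1 + t * b by near: t.
by rewrite fctE/= lnM ?ln_div// posrE ?divr_gt0.
Unshelve. all: by end_near. Qed.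

End elementary_bounds.

Section density_null_sets.
Context d (T : measurableType d) (R : realType).

Lemma ae_dominates (m : {measure set T -> \bar R}) (P : {measure set T -> \bar R})
    (Q : T -> Prop) : P `<< m -> {ae m, forall w, Q w} -> {ae P, forall w, Q w}.
Proof.
move=> /null_content_dominatesP Pm [A [mA mA0 QA]].
by exists A; split=> //; exact: Pm.
Qed.

Lemma density_gt0 (m : {measure set T -> \bar R}) (P : probability T R)
    (p : T -> R) : measurable_fun setT p -> (forall w, 0 <= p w) ->
  (forall A, measurable A -> P A = (\int[m]_(w in A) (p w)%:E)%E) ->
  {ae P, forall w, 0 < p w}.
Proof.
move=> mp p0 Pp; exists (p @^-1` [set 0]).
have mA : measurable (p @^-1` [set 0]).
  by rewrite -[X in measurable X]setTI; exact: mp.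
split => //; last by move=> w /= /negP; rewrite lt_def p0 andbT negbK => /eqP.
by rewrite Pp//; apply: integral0_eq => w /= ->.
Qed.

End density_null_sets.

(** * Scores of families of the form p (1 + c.s) / (1 + c.n) *)

Section score_of_ratio.
Context d (T : measurableType d) (R : realType).
Variables (m : {measure set T -> \bar R}) (P : probability T R).
Variables (r : nat) (p : 'cV[R]_r -> T -> R) (s n : T -> 'cV[R]_r) (M del : R).
Hypotheses (M0 : 0 <= M) (del0 : 0 < del).
Hypotheses (mp : forall c, measurable_fun setT (p c)) (p_ge0 : forall c w, 0 <= p c w).
Hypothesis Pp : forall A, measurable A -> P A = (\int[m]_(w in A) (p 0 w)%:E)%E.
Hypothesis pE : {ae m, forall w, forall c, dotv c c < del ->
  p c w = p 0 w * ((1 + dotv c (s w)) / (1 + dotv c (n w)))}.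
Hypotheses (ms : forall i, measurable_fun setT (fun w => s w i 0))
  (mn : forall i, measurable_fun setT (fun w => n w i 0))
  (sM : forall w i, `|s w i 0| <= M) (nM : forall w i, `|n w i 0| <= M).

Let S w := s w - n w.

Let mS i : measurable_fun setT (fun w => S w i 0).
Proof.
rewrite (_ : (fun w => _) = (fun w => s w i 0 - n w i 0)).
  exact: measurable_funB.
by apply/funext => w; rewrite !mxE.
Qed.

Let SM w i : `|S w i 0| <= 2 * M.
Proof.
rewrite !mxE (le_trans (ler_normB _ _))//.
have := sM w i; have := nM w i; lra.
Qed.

Let K := r%:R * M.

(** Both inner products are at most K |h|, so [sqrt_ratio_bound] leaves a remainder of at most 3 (2
    K |h|)^2, whose square is 144 K^4 |h|^4. The fourth order in |h| beats the second order allowed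
    in [is_score]. *)
Let sqrt_family_bound (h : 'cV[R]_r) w : dotv h h < (4 * K ^+ 2 + 1)^-1 ->
  p h w = p 0 w * ((1 + dotv h (s w)) / (1 + dotv h (n w))) ->
  (Num.sqrt (p h w) - Num.sqrt (p 0 w)
     - 2^-1 * dotv h (S w) * Num.sqrt (p 0 w)) ^+ 2 <=
  144 * K ^+ 4 * dotv h h ^+ 2 * p 0 w.
Proof.
move=> hK ->; rewrite sqrtrM// dotvBr.
have B := sqrt_ratio_bound (dotv_small M0 (sM w) hK) (dotv_small M0 (nM w) hK).
set u := dotv h (s w) in B *; set v := dotv h (n w) in B *.
set rho := Num.sqrt (dotv h h).
have ub : `|u| <= K * rho by exact: dotv_bound.
have vb : `|v| <= K * rho by exact: dotv_bound.
set X := _ - 1 - _ in B.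
have -> : Num.sqrt (p 0 w) * Num.sqrt ((1 + u) / (1 + v)) - Num.sqrt (p 0 w) -
    2^-1 * (u - v) * Num.sqrt (p 0 w) = X * Num.sqrt (p 0 w) by rewrite /X; ring.
rewrite exprMn sqr_sqrtr// ler_wpM2r//.
have rho2 : rho ^+ 2 = dotv h h by rewrite sqr_sqrtr ?dotv_ge0.
have -> : 144 * K ^+ 4 * dotv h h ^+ 2 = (3 * (K * rho + K * rho) ^+ 2) ^+ 2.
  by rewrite -rho2; ring.
have Kr : 0 <= K * rho by rewrite !mulr_ge0 ?sqrtr_ge0.
rewrite -[X ^+ 2]real_normK ?num_real//.
have XB : `|X| <= 3 * (K * rho + K * rho) ^+ 2.
  apply: (le_trans B); rewrite ler_wpM2l// lerXn2r ?nnegrE ?addr_ge0//.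
  exact: lerD.
by rewrite ler_sqr ?nnegrE// mulr_ge0// sqr_ge0.
Qed.

(** Serves both nuisance parameters: in a submodel for eta the factor is 1 + c.s(X) and n = 0, while
    in one for g the denominator 1 + c.n(X) is the relative change of the normaliser. The pointwise
    remainder is a multiple of the density, so it integrates to that multiple. *)
Lemma is_score_ratio :
  (\matrix_(i, j) \int[P]_w (S w i 0 * S w j 0)) \in unitmx ->
  is_score m P p 0 S.
Proof.
move=> unit; have p0 := p_ge0 0.
have sqE i : square_integrable P (fun w => S w i 0).
  by by apply: (@bounded_square_integrable _ _ _ _ (2 * M)) => // w; exact: SM.
split=> //.
- move=> j; have pP := ae_dominates (density_dominates (mp 0) Pp) pE.
  apply: filterS2 pP (density_gt0 (mp 0) p0 Pp) => w pEw pw.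
  have near_del : \forall t \near (0 : R), p (0 + t *: delta_mx j 0) w =
      p 0 w * ((1 + t * s w j 0) / (1 + t * n w j 0)).
    have : (t * t) @[t --> (0 : R)] --> (0 * 0 : R).
      by apply: cvgM; exact: cvg_id.
    rewrite mul0r => /cvgr_lt/(_ _ del0); apply: filterS => t td.
    by rewrite add0r pEw !dotv_delta// !mxE !eqxx mulr1.
  have gt0 (c : R) : \forall t \near (0 : R), 0 < 1 + t * c.
    have : (1 + t * c) @[t --> (0 : R)] --> (1 + 0 * c).
      by apply: cvgD; [exact: cvg_cst|apply: cvgMl; exact: cvg_id].
    rewrite mul0r addr0 => /cvgr_gt; apply; exact: ltr01.
  split.
    have sj := gt0 (s w j 0); have nj := gt0 (n w j 0).
    near=> t.
    have -> : p (0 + t *: delta_mx j 0) w =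
      p 0 w * ((1 + t * s w j 0) / (1 + t * n w j 0)) by near: t.
    rewrite mulr_gt0// divr_gt0//; by near: t.
  have := is_derive_ln_ratio (s w j 0) (n w j 0) pw.
  rewrite (_ : S w j 0 = s w j 0 - n w j 0); last by rewrite !mxE.
  apply: near_eq_is_derive; apply: filterS near_del => t ->; by [].
- move=> e e0.
  (* Below [d1] both inner products are at most 1/2; below [d2] one has 144 K^4 |h|^2 <= e; below
     [del] the family has its ratio form. *)
  pose d1 := (4 * K ^+ 2 + 1)^-1; pose d2 := e / (144 * K ^+ 4 + 1).
  have k2 : 0 < 4 * K ^+ 2 + 1 by have := sqr_ge0 K; lra.
  have K4 : 0 <= K ^+ 4 by rewrite (exprM K 2 2) sqr_ge0.
  have k4 : 0 < 144 * K ^+ 4 + 1 by lra.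
  have d10 : 0 < d1 by rewrite invr_gt0.
  have d20 : 0 < d2 by rewrite divr_gt0.
  exists (Num.min del (Num.min d1 d2)); first by rewrite !lt_min del0 d10 d20.
  move=> h; rewrite !lt_min => /and3P[hdel h1 h2].
  have hh0 := dotv_ge0 h.
  have h2' : 144 * K ^+ 4 * dotv h h ^+ 2 <= e * dotv h h.
    have : dotv h h * (144 * K ^+ 4 + 1) < e by rewrite -ltr_pdivlMr.
    move=> ?; rewrite expr2 mulrA ler_wpM2r//; nra.
  apply: (@le_trans _ _ (\int[m]_w ((e * dotv h h)%:E * (p 0 w)%:E))%E).
    apply: ae_ge0_le_integral => //.
    + by move=> w _; rewrite lee_fin sqr_ge0.
    + apply/measurable_EFinP; apply: measurable_funX.
      have msq c : measurable_fun setT (fun w => Num.sqrt (p c w)).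
        apply: measurableT_comp => //.
        by apply: continuous_measurable_fun; exact: sqrt_continuous.
      apply: measurable_funB; first exact: measurable_funB.
      apply: measurable_funM => //; apply: measurable_funM => //.
      exact: measurable_dotv.
    + by move=> w _; rewrite -EFinM lee_fin !mulr_ge0// ltW.
    + by apply: emeasurable_funM => //; apply/measurable_EFinP; exact: mp.
    + apply: filterS pE => w pEw _; rewrite -EFinM lee_fin.
      rewrite add0r; apply: (le_trans (sqrt_family_bound h1 (pEw h hdel))).
      by rewrite ler_wpM2r.
  rewrite ge0_integralZl_EFin//.
  + by rewrite -Pp// probability_setT mule1.
  + by move=> w _; rewrite lee_fin.
  + by apply/measurable_EFinP; exact: mp.
  + by rewrite mulr_ge0// ltW.
- move=> j; have [_ Sj] := sqE j; rewrite unlock.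
  exact: integrable_lty Sj.
- rewrite (_ : \matrix_(i, j) _ = \matrix_(i, j) \int[P]_w (S w i 0 * S w j 0))//.
  by apply/matrixP => i j; rewrite !mxE unlock.
Unshelve. all: by end_near. Qed.

End score_of_ratio.

(** * Reduction to a nonsingular Gram matrix *)

Section anisotropic_reduction.
Context (R : realFieldType).

Let dot_eq0 n (u : 'rV[R]_n) : u *m u^T = 0 -> u = 0.
Proof.
move=> /matrixP/(_ 0 0); rewrite !mxE; under eq_bigr do rewrite mxE -expr2.
move=> /psumr_eq0P h; apply/rowP => i; rewrite mxE; apply/eqP.
by rewrite -sqrf_eq0 h// => j _; rewrite sqr_ge0.
Qed.

Variables (q : nat) (G : 'M[R]_q).
Hypotheses (Gsym : G^T = G)
  (Gker : forall u : 'rV[R]_q, u *m G *m u^T = 0 -> u *m G = 0).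

(** By symmetry the kernel of G is orthogonal to its row space, and over a real field a vector
    orthogonal to itself is 0. *)
Let row_space_ker (u : 'rV[R]_q) : (u <= G)%MS -> u *m G = 0 -> u = 0.
Proof.
move=> /submxP[w ->] wGG; apply: dot_eq0.
by rewrite trmx_mul Gsym mulmxA wGG mul0mx.
Qed.

(** The rows of A form a basis of the row space of G. If v kills A G A^T, then vA is isotropic,
    hence in the kernel of G by [Gker], and also in the row space, so vA = 0 and v = 0. *)
Lemma anisotropic_reduction : exists r (A : 'M[R]_(r, q)) (C : 'M[R]_(q, r)),
  A *m G *m A^T \in unitmx /\ C *m A *m G = G.
Proof.
have [A [freeA eqA]] : exists A : 'M[R]_(\rank G, q), row_free A /\ (A :=: G)%MS.
  by exists (row_base G); split; [exact: row_base_free|exact: eq_row_base].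
have unitA : A *m G *m A^T \in unitmx.
  rewrite -row_free_unit; apply: inj_row_free => v vA0.
  have uG : v *m A *m G = 0.
    by apply: Gker; move: vA0; rewrite trmx_mul !mulmxA => ->; rewrite mul0mx.
  apply/eqP; rewrite -(mulmx_free_eq0 _ freeA); apply/eqP.
  apply: row_space_ker uG; apply: submx_trans (submxMl _ _) _.
  by rewrite eqA.
(* The row space of AG lies in that of G, and AG has rank at least that of the invertible A G A^T,
   namely the rank of G; so the two row spaces agree and C can be read off. *)
have GAG : (G <= A *m G)%MS.
  have AG : (A *m G <= G)%MS by exact: submxMl.
  rewrite -(mxrank_leqif_sup AG) eqn_leq mxrankS//=.
  by rewrite -{1}(mxrank_unit unitA) mxrankM_maxl.
have [C CE] := submxP GAG.
by exists (\rank G), A, C; split; rewrite // -mulmxA -CE.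
Qed.

End anisotropic_reduction.

Section gram_of_random_vector.
Context d (T : measurableType d) (R : realType).
Variable P : probability T R.

Definition gram n (S : T -> 'cV[R]_n) : 'M[R]_n :=
  \matrix_(i, j) \int[P]_w (S w i 0 * S w j 0).

Variables (q : nat) (S : T -> 'cV[R]_q).
Hypothesis sqS : forall i, square_integrable P (fun w => S w i 0).

Lemma square_integrable_mulmx n (B : 'M[R]_(n, q)) i :
  square_integrable P (fun w => (B *m S w) i 0).
Proof.
apply: square_integrable_eq (_ : square_integrable P (fun w => \sum_k B i k * S w k 0)).
  by move=> w; rewrite mxE.
by apply: square_integrable_sum => k; exact: square_integrableZ.
Qed.

Lemma gram_mulmx n p (B : 'M[R]_(n, q)) (D : 'M[R]_(p, q)) i j :
  \int[P]_w ((B *m S w) i 0 * (D *m S w) j 0) = (B *m gram S *m D^T) i j.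
Proof.
have iS k l : integrableR P (fun w => S w k 0 * S w l 0).
  exact: square_integrableM.
transitivity (\int[P]_w (\sum_l \sum_k (D j l * B i k) * (S w k 0 * S w l 0))).
  apply: eq_Rintegral => w _; rewrite !mxE mulr_sumr; apply: eq_bigr => l _.
  by rewrite mulr_suml; apply: eq_bigr => k _; ring.
rewrite Rintegral_sum => [|l]; last first.
  by apply: integrableR_sum => k; exact: integrableRZ.
rewrite mxE; apply: eq_bigr => l _; rewrite Rintegral_sum => [|k]; last first.
  exact: integrableRZ.
rewrite !mxE mulr_suml; apply: eq_bigr => k _.
by rewrite RintegralZl; [rewrite /gram mxE; ring| |exact: iS].
Qed.

(** A Gram matrix satisfies the anisotropy condition because u G u^T is the second moment of u.S: if
    it is 0, then u.S = 0 almost surely and uG = 0. For B = CA - 1, BG = 0 says in the same way that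
    BS = 0 almost surely, so C recovers S from AS. *)
Lemma gram_reduction : exists r (A : 'M[R]_(r, q)) (C : 'M[R]_(q, r)),
  gram (fun w => A *m S w) \in unitmx /\
  {ae P, forall w, C *m (A *m S w) = S w}.
Proof.
have gramM n (B : 'M[R]_(n, q)) : gram (fun w => B *m S w) = B *m gram S *m B^T.
  by apply/matrixP => i j; rewrite mxE gram_mulmx.
have S1 w : S w = 1%:M *m S w by rewrite mul1mx.
have ae0 n (B : 'M[R]_(n, q)) i : (B *m gram S *m B^T) i i = 0 ->
    {ae P, forall w, (B *m S w) i 0 = 0}.
  rewrite -gram_mulmx => BB; apply: Rintegral_sqr_eq0.
    exact: square_integrable_mulmx.
  by under eq_Rintegral do rewrite expr2.
have [||r [A [C [uA CA]]]] := @anisotropic_reduction R q (gram S).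
- by apply/matrixP => i j; rewrite !mxE; apply: eq_Rintegral => w _; rewrite mulrC.
- move=> u uGu; apply/rowP => j; have uS : {ae P, forall w, (u *m S w) 0 0 = 0}.
    by apply: ae0; rewrite uGu mxE.
  have := gram_mulmx u (1%:M : 'M[R]_q) 0 j.
  rewrite trmx1 mulmx1 => <-; rewrite mxE.
  under eq_Rintegral do rewrite mul1mx.
  have [mu _] := square_integrable_mulmx u 0; have [mj _] := sqS j.
  rewrite (@ae_eq_Rintegral _ _ _ _ _ (fun=> 0)).
  + by rewrite /Rintegral integral0.
  + exact: measurable_funM.
  + exact: measurable_cst.
  + by apply: filterS uS => w ->; rewrite mul0r.
exists r, A, C; split; first by rewrite gramM.
have : {ae P, forall w, forall i, ((C *m A - 1%:M) *m S w) i 0 = 0}.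
  apply: filter_forall => i; apply: ae0.
  by rewrite mulmxBl CA mul1mx subrr mul0mx mxE.
apply: filterS => w h; apply/eqP; rewrite -subr_eq0; apply/eqP/colP => i.
by rewrite [RHS]mxE -[RHS](h i) mulmxBl mul1mx mulmxA.
Qed.

End gram_of_random_vector.

Lemma EFinMA (R : realType) (x y z : R) :
  ((x * y)%:E * z%:E = x%:E * (y * z)%:E)%E.
Proof. by rewrite -!EFinM mulrA. Qed.

(** * The conditional mean of a bounded function of Y given X *)

Section conditional_mean_given_X.
Context (R : realType) (q : nat).
Variables (nu : {sigma_finite_measure set R -> \bar R})
  (mu : {sigma_finite_measure set (q.-tuple R) -> \bar R}).
Variables (b : 'cV[R]_q) (g : R -> R) (eta : q.-tuple R -> R).
Variable P : probability (R * q.-tuple R)%type R.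
Hypotheses (hm : plr_model nu mu b g eta) (hl : plr_law nu mu b g eta P).

Let p := plr_dens nu b g eta.

Lemma model_measurable_dens : measurable_fun setT p.
Proof. by have [[mg g0 _] [me _ _] _] := hm; exact: measurable_plr_dens. Qed.

Lemma model_dens_ge0 z : 0 <= p z.
Proof. by have [[mg g0 _] [me e0 _] _] := hm; exact: plr_dens_ge0. Qed.

Let mp := model_measurable_dens.
Let p0 := model_dens_ge0.

Let density_integral F := @density_ge0_integral _ _ _ (nu \x mu)%E P p mp p0 hl F.

Let integral_preimage_snd (F : R * q.-tuple R -> R) (B : set (q.-tuple R)) :
  measurable_fun setT F -> (forall z, 0 <= F z) -> measurable B ->
  (\int[P]_(w in snd @^-1` B) (F w)%:E =
   \int[(nu \x mu)]_z ((\1_B z.2)%:E * (F z * p z)%:E))%E.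
Proof.
move=> mF F0 mB.
have m1 : measurable_fun setT (fun z : R * q.-tuple R => \1_B z.2 * F z).
  apply: measurable_funM => //; apply: (measurableT_comp (f := \1_B : _ -> R)) => //.
rewrite integral_mkcond (eq_integral (fun z => (\1_B z.2 * F z)%:E)); last first.
  move=> z _; rewrite patchE indicE.
  have -> : (z \in snd @^-1` B) = (z.2 \in B) by apply/idP/idP; rewrite !inE.
  by case: (z.2 \in B); rewrite ?mul1r ?mul0r.
rewrite density_integral.
- by apply: eq_integral => z _; exact: EFinMA.
- exact/measurable_EFinP.
- by move=> z; rewrite lee_fin mulr_ge0// indicE.
Qed.

(** Tested on {X in B}, both sides become the integral over B of the tilted mean times [eta]: the
    left one by integrating out y, the right one by the marginal law of X. *)
Let is_condE_tilted_mean (s : R -> R) M : measurable_fun setT s ->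
  (forall y, 0 <= s y <= M) ->
  is_condE P snd (fun z => s z.1) (tilted_mean nu b g s).
Proof.
move=> ms sM; have [hg he fin] := hm; have [mg g0 _] := hg.
have s0 y : 0 <= s y by case/andP: (sM y).
have mt : measurable_fun setT (tilted_mean nu b g s) by exact: measurable_tilted_mean.
have tM x := tilted_mean_bound b x hg ms sM.
have t0 x : 0 <= tilted_mean nu b g s x by case/andP: (tM x).
split=> //.
  apply: (@bounded_integrableR _ _ _ _ M); first exact: measurableT_comp.
  by move=> w /=; rewrite ger0_norm//; case/andP: (tM w.2).
move=> B mB; have m1 : measurable_fun setT (EFin \o (\1_B : q.-tuple R -> R)).
  by apply/measurable_EFinP; exact: measurable_indic.
have ms1 : measurable_fun setT (fun z : R * q.-tuple R => s z.1).
  exact: measurableT_comp.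
have mt2 : measurable_fun setT (fun z : R * q.-tuple R => tilted_mean nu b g s z.2).
  exact: measurableT_comp.
rewrite (integral_preimage_snd ms1 (fun z => s0 z.1) mB).
rewrite (integral_preimage_snd mt2 (fun z => t0 z.2) mB).
rewrite (integral_plr_dens hm ms sM m1); last by move=> x; rewrite lee_fin indicE.
transitivity (\int[nu \x mu]_z
    ((\1_B z.2 * tilted_mean nu b g s z.2)%:E * (p z)%:E))%E; last first.
  by apply: eq_integral => z _; exact: EFinMA.
rewrite (plr_dens_marginal (u := fun x => (\1_B x * tilted_mean nu b g s x)%:E) hm).
- by apply: eq_integral => x _; rewrite EFinMA.
- by apply/measurable_EFinP; apply: measurable_funM; [exact: measurable_indic|exact: mt].
- by move=> x; rewrite lee_fin mulr_ge0// indicE.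
Qed.

(* A bounded [s] is shifted to be nonnegative, as [plr_norm] integrates in the
   extended reals. *)
Definition cond_mean (M : R) (s : R -> R) (x : q.-tuple R) : R :=
  tilted_mean nu b g (fun y => s y + M) x - M.

Variables (s : R -> R) (M : R).
Hypotheses (ms : measurable_fun setT s) (sM : forall y, `|s y| <= M).

Let sM2 y : 0 <= s y + M <= 2 * M.
Proof. by have := sM y; rewrite ler_norml => /andP[? ?]; apply/andP; split; lra. Qed.

Let msM : measurable_fun setT (fun y => s y + M).
Proof. exact: measurable_funD. Qed.

Lemma measurable_cond_mean : measurable_fun setT (cond_mean M s).
Proof.
have [[mg g0 _] _ _] := hm; apply: measurable_funB => //.
by apply: measurable_tilted_mean => // y; case/andP: (sM2 y).
Qed.

Lemma cond_mean_bound x : `|cond_mean M s x| <= M.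
Proof.
have [hg _ _] := hm; have /andP[t1 t2] := tilted_mean_bound b x hg msM sM2.
by rewrite ler_norml; apply/andP; split; rewrite /cond_mean; lra.
Qed.

Lemma is_condE_cond_mean : is_condE P snd (fun z => s z.1) (cond_mean M s).
Proof.
have i1 : integrableR P (fun z => s z.1 + M).
  apply: (@bounded_integrableR _ _ _ _ (2 * M)).
    exact: (measurableT_comp (f := fun y => s y + M)).
  by move=> w; have /andP[? ?] := sM2 w.1; rewrite ger0_norm.
have i2 : integrableR P (fun=> M).
  exact: (finite_measure_integrable_cst P M measurableT).
have cM : is_condE P snd (fun=> M) (fun=> M : R) by split.
have := is_condEB measurable_snd i1 i2 (is_condE_tilted_mean msM sM2) cM.
have -> : (fun z : R * q.-tuple R => s z.1 + M - M) = (fun z => s z.1).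
  by apply/funext => z; rewrite addrK.
by [].
Qed.

Let tilt x y := expR (dotv b (vec_of_tuple x) * y).

Lemma integrable_tilt x : (plr_norm nu b g x < +oo)%E ->
  integrableR nu (fun y => tilt x y * g y).
Proof.
have [[mg g0 _] _ _] := hm; move=> fin; apply/integrableP; split.
  apply/measurable_EFinP; apply: measurable_funM => //.
  exact: (measurable_fun_pair1 x (measurable_tilt b)).
under eq_integral do rewrite /= ger0_norm ?mulr_ge0 ?expR_ge0//.
exact: fin.
Qed.

Lemma integrable_tilt_bounded x : (plr_norm nu b g x < +oo)%E ->
  integrableR nu (fun y => tilt x y * g y * s y).
Proof.
move=> fin; have ix := integrable_tilt fin; have [[mg g0 _] _ _] := hm.
apply: integrableR_le (integrableRZ M ix).
  by apply: measurable_funM => //; exact: integrableR_measurable ix.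
move=> y; have t0 : 0 <= tilt x y * g y by rewrite mulr_ge0// expR_ge0.
by rewrite normrM (ger0_norm t0) mulrC ler_wpM2r.
Qed.

(** Cleared of the denominator, the shift by [M] cancels and an integral linear in [s] remains. In
    this form the conditional mean appears as the relative change of the normaliser when g is
    perturbed along s. *)
Lemma cond_meanE x : (plr_norm nu b g x < +oo)%E ->
  cond_mean M s x * fine (plr_norm nu b g x) = \int[nu]_y (tilt x y * g y * s y).
Proof.
move=> fin; have [hg _ _] := hm.
have ix := integrable_tilt fin; have ixs := integrable_tilt_bounded fin.
rewrite mulrBl /tilted_mean divfK ?gt_eqF ?fine_plr_norm_gt0//.
rewrite -/(Rintegral nu setT (fun y => tilt x y * (g y * (s y + M)))).
rewrite -/(Rintegral nu setT (fun y => tilt x y * g y)).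
rewrite -RintegralZl// -RintegralB//.
- by apply: eq_Rintegral => y _; ring.
- apply: integrableR_eq (integrableRD ixs (integrableRZ M ix)) => y; ring.
- exact: integrableRZ.
Qed.

End conditional_mean_given_X.

Section small_perturbations.
Context (R : realType).

Lemma dotv_mulmx r q (c : 'cV[R]_r) (A : 'M[R]_(r, q)) (v : 'cV[R]_q) :
  dotv c (A *m v) = dotv (A^T *m c) v.
Proof. by rewrite /dotv trmx_mul trmxK mulmxA. Qed.

Lemma mulmx_bounded r q (A : 'M[R]_(r, q)) M : 0 <= M -> exists2 M', 0 <= M' &
  forall v : 'cV[R]_q, (forall i, `|v i 0| <= M) -> forall j, `|(A *m v) j 0| <= M'.
Proof.
move=> M0; exists (\sum_j \sum_k `|A j k| * M) => [|v vM j].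
  by do 2 (apply: sumr_ge0 => ? _); exact: mulr_ge0.
rewrite mxE (le_trans (ler_norm_sum _ _ _))//.
rewrite [leRHS](bigD1 j)//= ler_wpDr//.
  by do 2 (apply: sumr_ge0 => ? _); exact: mulr_ge0.
by apply: ler_sum => k _; rewrite normrM ler_wpM2l.
Qed.

(** Used twice for a perturbed g: with w = g for its total mass, and with w the tilted g for its
    normaliser. *)
Lemma Rintegral_affine d (T : measurableType d) (m : {measure set T -> \bar R}) q
    (w : T -> R) (s : T -> 'cV[R]_q) (kap e : 'cV[R]_q) :
  integrableR m w -> (forall i, integrableR m (fun y => w y * s y i 0)) ->
  \int[m]_y (w y * (1 + dotv e (s y - kap))) =
  (1 - dotv e kap) * \int[m]_y w y + \sum_i e i 0 * \int[m]_y (w y * s y i 0).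
Proof.
move=> iw iws.
transitivity (\int[m]_y ((1 - dotv e kap) * w y + \sum_i e i 0 * (w y * s y i 0))).
  apply: eq_Rintegral => y _.
  have -> : \sum_i e i 0 * (w y * s y i 0) = w y * dotv e (s y).
    by rewrite dotvE mulr_sumr; apply: eq_bigr => i _; ring.
  by rewrite dotvBr; ring.
rewrite RintegralD//.
- rewrite RintegralZl// Rintegral_sum => [|i]; last exact: integrableRZ.
  by congr (_ + _); apply: eq_bigr => i _; rewrite RintegralZl//; exact: iws.
- exact: integrableRZ.
- by apply: integrableR_sum => i; exact: integrableRZ.
Qed.

Lemma Rintegral_probability_cst d (T : measurableType d) (P : probability T R) (c : R) :
  \int[P]_w c = c.
Proof. by rewrite Rintegral_cst// [X in fine X](@probability_setT _ _ _ P) mulr1. Qed.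

Lemma ae_snd d d' (T : measurableType d) (U : measurableType d')
    (m : {measure set T -> \bar R}) (m' : {sigma_finite_measure set U -> \bar R})
    (Q : U -> Prop) :
  {ae m', forall x, Q x} -> {ae (m \x m')%E, forall z, Q z.2}.
Proof.
move=> [N [mN mN0 QN]]; exists (setT `*` N); split.
- exact: measurableX.
- by rewrite [LHS]product_measure1E// mN0 mule0.
- by move=> z /= Qz; split => //; exact: QN.
Qed.

End small_perturbations.

(** * Submodels with prescribed bounded scores *)

Section submodels.
Context (R : realType) (q : nat).
Variables (nu : {sigma_finite_measure set R -> \bar R})
  (mu : {sigma_finite_measure set (q.-tuple R) -> \bar R}).
Variables (b : 'cV[R]_q) (g : R -> R) (eta : q.-tuple R -> R).
Variable P : probability (R * q.-tuple R)%type R.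
Hypotheses (hm : plr_model nu mu b g eta) (hl : plr_law nu mu b g eta P).

Let mp := model_measurable_dens hm.
Let p0 := model_dens_ge0 hm.

Section eta_submodel.
Variables (r : nat) (s : q.-tuple R -> 'cV[R]_r) (M : R).
Hypotheses (M0 : 0 <= M) (ms : forall i, measurable_fun setT (fun x => s x i 0))
  (sM : forall x i, `|s x i 0| <= M)
  (s0 : forall i, \int[P]_z s z.2 i 0 = 0)
  (unit : gram P (fun z => s z.2) \in unitmx).

Let del := (4 * (r%:R * M) ^+ 2 + 1)^-1.

Let del0 : 0 < del.
Proof. by rewrite invr_gt0; have := sqr_ge0 (r%:R * M); lra. Qed.

(** Outside the ball of radius given by [del] the factor 1 + c.s might be negative, so the family
    stays constant there; inside, |c.s| <= 1/2 keeps it positive. *)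
Let ef (c : 'cV[R]_r) x :=
  if dotv c c < del then eta x * (1 + dotv c (s x)) else eta x.

Let small c x : dotv c c < del -> `|dotv c (s x)| <= 2^-1.
Proof. by move=> h; apply: dotv_small h. Qed.

Let ef0 : ef 0 = eta.
Proof.
by apply/funext => x; rewrite /ef !dotvE !big1 ?del0 ?addr0 ?mulr1// => i _;
  rewrite mxE mul0r.
Qed.

Let measurable_ef c : measurable_fun setT (ef c).
Proof.
have [_ [me _ _] _] := hm; rewrite /ef; case: (dotv c c < del) => //.
by apply: measurable_funM => //; apply: measurable_funD => //; exact: measurable_dotv.
Qed.

Let ef_model c : plr_model nu mu b g (ef c).
Proof.
have [hg [me e0 e1] fin] := hm; split=> //; last first.
  apply: filterS fin => x fin h; apply: fin; move: h; rewrite /ef.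
  case: ifP => // _ h; rewrite lt_def e0 andbT; apply: contraTN h => /eqP ->.
  by rewrite mul0r ltxx.
split=> //.
  move=> x; rewrite /ef; case: ifP => // cd; rewrite mulr_ge0//.
  by have := small x cd; rewrite ler_norml => /andP[]; lra.
rewrite /ef; have [cd|_] := boolP (dotv c c < del); last exact: e1.
pose u x := 1 + dotv c (s x).
have mu_ : measurable_fun setT u.
  by apply: measurable_funD => //; exact: measurable_dotv.
have u0 x : 0 <= u x.
  by have := small x cd; rewrite /u ler_norml => /andP[]; lra.
transitivity (\int[mu]_x ((u x)%:E * (eta x)%:E))%E.
  by apply: eq_integral => x _; rewrite -EFinM mulrC.
(* The total mass is rewritten as an expectation under P, where [s0] says that s(X) is centred. *)
rewrite -(plr_dens_marginal (u := EFin \o u) hm)//; last exact/measurable_EFinP.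
have mu2 : measurable_fun setT (fun z : R * q.-tuple R => (u z.2)%:E).
  by apply/measurable_EFinP; exact: (measurableT_comp mu_).
rewrite -(density_ge0_integral mp p0 hl mu2); last by move=> z; rewrite lee_fin.
have ints i : integrableR P (fun z => s z.2 i 0).
  apply: (@bounded_integrableR _ _ _ _ M) => [|w]; last exact: sM.
  exact: (measurableT_comp (ms i)).
have int1 : integrableR P (fun=> 1 : R).
  exact: (finite_measure_integrable_cst P (1 : R) measurableT).
have intd : integrableR P (fun z => dotv c (s z.2)).
  apply: integrableR_eq (_ : integrableR P (fun z => \sum_i c i 0 * s z.2 i 0)).
    by move=> z; rewrite dotvE.
  by apply: integrableR_sum => i; exact: integrableRZ.
have intu : integrableR P (fun z => u z.2) by exact: integrableRD.
rewrite -[LHS]fineK ?integrable_fin_num//; congr EFin.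
rewrite -/(Rintegral P setT (fun z => u z.2)) RintegralD//.
have -> : \int[P]_z (1 : R) = 1.
  exact: Rintegral_probability_cst.
under eq_Rintegral do rewrite dotvE.
rewrite Rintegral_sum => [|i]; last exact: integrableRZ.
rewrite big1 ?addr0// => i _; rewrite RintegralZl//; last exact: ints.
by rewrite s0 mulr0.
Qed.

Lemma eta_submodel_score (C : 'M[R]_(q, r)) :
  nuisance_scores_eta nu mu b g eta P (fun z => C *m s z.2).
Proof.
exists r, ef, 0, (fun z => s z.2), C; split=> //.
have hp : forall A, measurable A ->
    P A = (\int[(nu \x mu)%E]_(z in A) (plr_dens nu b g (ef 0) z)%:E)%E.
  by rewrite ef0.
have -> : (fun z => s z.2) = (fun z : R * q.-tuple R => s z.2 - 0).
  by apply/funext => z; rewrite subr0.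
apply: (is_score_ratio (s := fun z => s z.2) (n := fun=> 0) (M := M) (del := del)) => //.
- by move=> c; exact: (model_measurable_dens (ef_model c)).
- by move=> c z; exact: (model_dens_ge0 (ef_model c)).
- apply: aeW => z c cd; rewrite ef0 /plr_dens /ef cd.
  rewrite (_ : dotv c 0 = 0) ?addr0 ?divr1; last by rewrite /dotv mulmx0 mxE.
  by rewrite mulrA.
- by move=> i; exact: (measurableT_comp (ms i)).
- by move=> z i; rewrite mxE normr0.
- rewrite (_ : \matrix_(i, j) _ = gram P (fun z => s z.2))//.
  apply/matrixP => i j; rewrite !mxE.
  by apply: eq_Rintegral => z _; rewrite subr0.
Qed.

End eta_submodel.

Section g_submodel.
Variables (s : R -> 'cV[R]_q) (M : R).
Hypotheses (M0 : 0 <= M) (ms : forall i, measurable_fun setT (fun y => s y i 0))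
  (sM : forall y i, `|s y i 0| <= M).

Let n x : 'cV[R]_q := \col_i cond_mean nu b g M (fun y => s y i 0) x.

Variables (r : nat) (A : 'M[R]_(r, q)).
Hypothesis unit : gram P (fun z => A *m (s z.1 - n z.2)) \in unitmx.

(* The mean of [s] under the law of Y given X = 0: the perturbation of [g] has to
   be centred there, while the centring cancels in the score. *)
Let kap : 'cV[R]_q := \col_i \int[nu]_y (g y * s y i 0).

Let int_g : integrableR nu g.
Proof.
have [[mg g0 g1] _ _] := hm; apply/integrableP; split; first exact/measurable_EFinP.
by under eq_integral do rewrite /= ger0_norm ?g0//; rewrite g1 ltry.
Qed.

Let int_gs i : integrableR nu (fun y => g y * s y i 0).
Proof.
have [[mg g0 _] _ _] := hm; apply: integrableR_le (integrableRZ M int_g).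
  exact: measurable_funM.
by move=> y; rewrite normrM (ger0_norm (g0 y)) mulrC ler_wpM2r.
Qed.

Let Rint_g : \int[nu]_y g y = 1.
Proof. by have [[_ _ g1] _ _] := hm; rewrite /Rintegral g1. Qed.

Let kapM i : `|kap i 0| <= M.
Proof.
rewrite mxE (le_trans (le_normr_Rintegral _ (int_gs i)))//.
rewrite -[leRHS]mulr1 -Rint_g -RintegralZl//; apply: le_Rintegral => //.
- exact: integrable_norm (int_gs i).
- exact: integrableRZ.
move=> y _; have [[_ g0 _] _ _] := hm.
by rewrite normrM (ger0_norm (g0 y)) mulrC ler_wpM2r.
Qed.

Let nM x i : `|n x i 0| <= M.
Proof. by rewrite mxE; apply: (cond_mean_bound hm). Qed.

Let sk y i : `|(s y - kap) i 0| <= 2 * M.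
Proof.
by rewrite mxE [X in _ + X]mxE (le_trans (ler_normB _ _))// mulr2n mulrDl !mul1r lerD.
Qed.

Let nk x i : `|(n x - kap) i 0| <= 2 * M.
Proof.
by rewrite mxE [X in _ + X]mxE (le_trans (ler_normB _ _))// mulr2n mulrDl !mul1r lerD.
Qed.

(** Multiplying g by 1 + c.A(s - kap) multiplies the normaliser at x by 1 + c.A(n(x) - kap). The
    score is the difference A(s - kap) - A(n - kap) = A(s - n), whose Gram matrix is the one assumed
    invertible. *)
Lemma g_submodel_score (C : 'M[R]_(q, r)) :
  nuisance_scores_g nu mu b g eta P (fun z => C *m (A *m (s z.1 - n z.2))).
Proof.
have [hg [me e0 e1] fin] := hm; have [mg g0 g1] := hg.
(* 2M bounds the entries of s - kap and of n - kap; M' bounds them after applying A. *)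
have [M' M'0 AM] := mulmx_bounded A (mulr_ge0 (ler0n R 2) M0).
pose del := (4 * (r%:R * M') ^+ 2 + 1)^-1.
have del0 : 0 < del by rewrite invr_gt0; have := sqr_ge0 (r%:R * M'); lra.
have small c (v : 'cV[R]_q) : (forall i, `|v i 0| <= 2 * M) -> dotv c c < del ->
    `|dotv c (A *m v)| <= 2^-1.
  by move=> vM cd; apply: dotv_small cd => // i; exact: AM.
pose u c y := 1 + dotv c (A *m (s y - kap)).
pose gf c y := if dotv c c < del then g y * u c y else g y.
have gf0 : gf 0 = g.
  by apply/funext => y; rewrite /gf /u !dotvE !big1 ?del0 ?addr0 ?mulr1// => i _;
    rewrite mxE mul0r.
have mu_ c : measurable_fun setT (u c).
  apply: measurable_funD => //; under eq_fun do rewrite dotv_mulmx.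
  apply: measurable_dotv => i; under eq_fun do rewrite mxE.
  by apply: measurable_funD => //; exact: measurable_cst.
(* The lower bound keeps the perturbed g nonnegative; the upper bound keeps its normaliser finite
   wherever that of g is. *)
have u02 c y : dotv c c < del -> 0 <= u c y <= 2.
  move=> cd; have := small c _ (sk y) cd.
  by rewrite /u ler_norml => /andP[? ?]; apply/andP; split; lra.
have mgf c : measurable_fun setT (gf c).
  rewrite /gf; case: (dotv c c < del) => //; exact: measurable_funM.
have gf_ge0 c y : 0 <= gf c y.
  by rewrite /gf; case: ifP => // cd; rewrite mulr_ge0//; case/andP: (u02 c y cd).
have gfE c : dotv c c < del -> gf c = fun y => g y * u c y.
  by move=> cd; apply/funext => y; rewrite /gf cd.
have gf_model c : plr_model nu mu b (gf c) eta.
  have [cd|cd] := boolP (dotv c c < del); last first.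
    by rewrite (_ : gf c = g)//; apply/funext => y; rewrite /gf (negbTE cd).
  split=> //; last first.
    apply: filterS fin => x fin h; rewrite gfE//.
    by apply: (plr_normM_lty (M := 2)) (fin h) => // y; exact: u02.
  split=> //.
  have igf : integrableR nu (gf c).
    apply: integrableR_le (integrableRZ 2 int_g) => // y.
    rewrite ger0_norm// gfE// mulrC ler_wpM2r//; by case/andP: (u02 c y cd).
  rewrite -[LHS]fineK ?integrable_fin_num//; congr EFin.
  rewrite gfE// -/(Rintegral nu setT (fun y => g y * u c y)).
  under eq_Rintegral do rewrite /u dotv_mulmx.
  rewrite Rintegral_affine// Rint_g mulr1 -[RHS](subrK (dotv (A^T *m c) kap)).
  by congr (_ + _); rewrite dotvE; apply: eq_bigr => i _; rewrite [kap i 0]mxE.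
(* The normaliser is affine in the perturbation, and [cond_meanE] identifies the tilted integral of
   each s_i as n_i times the old normaliser. *)
have normE c x : dotv c c < del -> (plr_norm nu b g x < +oo)%E ->
    fine (plr_norm nu b (gf c) x) =
    fine (plr_norm nu b g x) * (1 + dotv c (A *m (n x - kap))).
  move=> cd finx; rewrite gfE//.
  pose w y := expR (dotv b (vec_of_tuple x) * y) * g y.
  have iw : integrableR nu w by exact: (integrable_tilt hm finx).
  have iws i : integrableR nu (fun y => w y * s y i 0).
    exact: (integrable_tilt_bounded hm (ms i) (fun y => sM y i) finx).
  rewrite -/(Rintegral nu setT (fun y => expR (dotv b (vec_of_tuple x) * y) * (g y * u c y))).
  under eq_Rintegral do rewrite mulrA /u dotv_mulmx.
  rewrite (Rintegral_affine kap (A^T *m c) iw iws).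
  rewrite (_ : \int[nu]_y w y = fine (plr_norm nu b g x))//.
  rewrite (eq_bigr (fun i => (A^T *m c) i 0 * n x i 0 * fine (plr_norm nu b g x))).
    by rewrite -mulr_suml -dotvE dotv_mulmx dotvBr; ring.
  move=> i _; rewrite [n x i 0]mxE -mulrA.
  by rewrite (cond_meanE hm (ms i) (fun y => sM y i) finx).
exists r, gf, 0, (fun z => A *m (s z.1 - n z.2)), C; split=> //.
have hp : forall B, measurable B ->
    P B = (\int[(nu \x mu)%E]_(z in B) (plr_dens nu b (gf 0) eta z)%:E)%E.
  by rewrite gf0.
have SE : (fun z : R * q.-tuple R => A *m (s z.1 - n z.2)) =
    (fun z => A *m (s z.1 - kap) - A *m (n z.2 - kap)).
  apply/funext => z; rewrite -mulmxBr; congr (_ *m _).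
  by rewrite opprB addrA subrK.
move: unit; rewrite SE => unit'.
apply: (is_score_ratio (s := fun z => A *m (s z.1 - kap))
  (n := fun z => A *m (n z.2 - kap)) (M := M') (del := del)) => //.
- by move=> c; exact: (model_measurable_dens (gf_model c)).
- by move=> c z; exact: (model_dens_ge0 (gf_model c)).
- apply: filterS (ae_snd nu fin) => z finz c cd; rewrite gf0 /plr_dens.
  (* Finiteness of the normaliser is known only where [eta] is positive; elsewhere both densities
     are 0. *)
  have [->|ez] := eqVneq (eta z.2) 0; first by rewrite !mulr0 mul0r.
  have {}finz : (plr_norm nu b g z.2 < +oo)%E.
    by apply: finz; rewrite lt_def ez e0.
  rewrite normE// gfE//.
  have N0 : fine (plr_norm nu b g z.2) != 0 by rewrite gt_eqF// fine_plr_norm_gt0.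
  have v0 : 1 + dotv c (A *m (n z.2 - kap)) != 0.
    rewrite gt_eqF//; have := small c _ (nk z.2) cd.
    by rewrite ler_norml => /andP[]; lra.
  by rewrite /u; field; rewrite N0 v0.
- move=> i; under eq_fun do rewrite mxE.
  apply: measurable_sum => k; apply: measurable_funM => //.
  under eq_fun do rewrite mxE.
  apply: measurable_funD; last exact: measurable_cst.
  exact: (measurableT_comp (ms k)).
- move=> i; under eq_fun do rewrite mxE.
  apply: measurable_sum => k; apply: measurable_funM => //.
  under eq_fun do rewrite mxE.
  apply: measurable_funD; last exact: measurable_cst.
  under eq_fun do rewrite mxE.
  apply: (measurableT_comp (f := cond_mean nu b g M (fun y => s y k 0))) => //.
  exact: (measurable_cond_mean hm).
- by move=> z i; exact: AM (sk z.1) i.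
- by move=> z i; exact: AM (nk z.2) i.
Qed.

End g_submodel.
End submodels.

(** * Scores integrate to zero over events of constant probability *)

Section score_mean_zero.
Context d (T : measurableType d) (R : realType).
Variables (m : {measure set T -> \bar R}) (P : probability T R).
Variables (r : nat) (p : 'cV[R]_r -> T -> R) (c0 : 'cV[R]_r) (S : T -> 'cV[R]_r).
Hypotheses (mp : forall c, measurable_fun setT (p c)) (p_ge0 : forall c w, 0 <= p c w)
  (ip : forall c, integrableR m (p c)).
Hypothesis Pp : forall A, measurable A -> P A = (\int[m]_(w in A) (p c0 w)%:E)%E.
Hypothesis hS : is_score m P p c0 S.
Variable D : set T.
Hypotheses (mD : measurable D)
  (pD : forall c, \int[m]_w (\1_D w * p c w) = \int[m]_w (\1_D w * p c0 w)).

Lemma score_square_integrable j : square_integrable P (fun w => S w j 0).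
Proof.
have [_ _ mS S2 _] := hS; split => //; apply/integrableP; split.
  by apply/measurable_EFinP; exact: measurable_funX.
have := S2 j; rewrite unlock; apply: le_lt_trans.
by under eq_integral do rewrite /= ger0_norm ?sqr_ge0//.
Qed.

(** Here r0 and r1 are root densities, i is an indicator and Q = r1 - r0 - t S0 r0 / 2. Expanding
    r1^2 leaves 2 r0 Q + (t S0 r0 / 2 + Q)^2. The cross term takes AM-GM with weight kt, because the
    integral of Q^2 will be at most k^2 t^2, which makes both resulting terms of order kt. *)
Let pointwise (i S0 r1 r0 t k : R) : 0 < t -> 0 < k -> 0 <= i <= 1 ->
  `|t * (i * S0 * r0 ^+ 2) - (i * r1 ^+ 2 - i * r0 ^+ 2)| <=
    k * t * r0 ^+ 2 + ((k * t)^-1 + 2) * (r1 - r0 - 2^-1 * (t * S0) * r0) ^+ 2 +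
    2^-1 * t ^+ 2 * (S0 ^+ 2 * r0 ^+ 2).
Proof.
move=> t0 k0 /andP[i0 i1].
pose Q : R := r1 - r0 - 2^-1 * (t * S0) * r0; rewrite -/Q.
have r1E : r1 = r0 + 2^-1 * (t * S0) * r0 + Q by rewrite /Q; ring.
clearbody Q.
have -> : t * (i * S0 * r0 ^+ 2) - (i * r1 ^+ 2 - i * r0 ^+ 2) =
    - (i * (2 * r0 * Q + (2^-1 * (t * S0) * r0 + Q) ^+ 2)).
  by rewrite r1E; field.
rewrite normrN normrM (ger0_norm i0).
apply: (@le_trans _ _ `|2 * r0 * Q + (2^-1 * (t * S0) * r0 + Q) ^+ 2|).
  by rewrite ler_piMl.
apply: (le_trans (ler_normD _ _)); rewrite (ger0_norm (sqr_ge0 _)).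
have kt0 : 0 < k * t by rewrite mulr_gt0.
have A : `|2 * r0 * Q| <= k * t * r0 ^+ 2 + (k * t)^-1 * Q ^+ 2.
  move: (k * t) kt0 => x x0.
  have key (z : R) : 0 <= x * r0 ^+ 2 + x^-1 * z ^+ 2 + 2 * r0 * z.
    have -> : x * r0 ^+ 2 + x^-1 * z ^+ 2 + 2 * r0 * z = x * (r0 + x^-1 * z) ^+ 2.
      by field; rewrite gt_eqF.
    by rewrite mulr_ge0 ?sqr_ge0// ltW.
  rewrite ler_norml; apply/andP; split; first by have := key Q; lra.
  by have := key (- Q); rewrite sqrrN; lra.
have B : (2^-1 * (t * S0) * r0 + Q) ^+ 2 <=
    2^-1 * t ^+ 2 * (S0 ^+ 2 * r0 ^+ 2) + 2 * Q ^+ 2.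
  have := sqr_ge0 (2^-1 * (t * S0) * r0 - Q).
  have -> : 2^-1 * t ^+ 2 * (S0 ^+ 2 * r0 ^+ 2) = 2 * (2^-1 * (t * S0) * r0) ^+ 2.
    by field.
  move: (2^-1 * (t * S0) * r0) => z; nra.
apply: le_trans (lerD A B) _; rewrite mulrDl; lra.
Qed.

(** The probability of D does not move by [pD], so t times the integral of S over D is pure
    linearisation error. Quadratic-mean differentiability is used with tolerance k^2; of the final
    bound, only 2kt is of first order in t. *)
Let small_step j k : 0 < k -> exists2 del, 0 < del & forall t, 0 < t -> t ^+ 2 < del ->
  t * `|\int[P]_w (\1_D w * S w j 0)| <=
    2 * k * t + t ^+ 2 * (2^-1 * \int[P]_w (S w j 0 ^+ 2) + 2 * k ^+ 2).
Proof.
move=> k0; have [_ dqm mS _ _] := hS.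
have [del del0 hdel] := dqm (k ^+ 2) (exprn_gt0 _ k0).
exists del => // t t0 tdel.
have [sS S2] := score_square_integrable j.
have m1 : measurable_fun setT (\1_D : T -> R) by exact: measurable_indic.
have i01 w : 0 <= (\1_D w : R) <= 1.
  by rewrite indicE; case: (_ \in _); rewrite ?lexx ?ler01.
pose h : 'cV[R]_r := t *: delta_mx j 0.
have hh : dotv h h = t ^+ 2 by rewrite dotv_delta !mxE !eqxx mulr1 expr2.
have hSw w : dotv h (S w) = t * S w j 0 by rewrite dotv_delta.
have := hdel h; rewrite hh => /(_ tdel).
under eq_integral do rewrite hSw.
set Q := fun w => Num.sqrt (p (c0 + h) w) - Num.sqrt (p c0 w) -
  2^-1 * (t * S w j 0) * Num.sqrt (p c0 w).
rewrite -/(\int[m]_w (Q w ^+ 2)%:E)%E => intQ.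
have msq c : measurable_fun setT (fun w => Num.sqrt (p c w)).
  apply: measurableT_comp => //.
  by apply: continuous_measurable_fun; exact: sqrt_continuous.
have mQ : measurable_fun setT Q.
  apply: measurable_funB; first exact: measurable_funB.
  by apply: measurable_funM => //; apply: measurable_funM => //; exact: measurable_funM.
have iQ : integrableR m (fun w => Q w ^+ 2).
  apply/integrableP; split; first by apply/measurable_EFinP; exact: measurable_funX.
  under eq_integral do rewrite /= ger0_norm ?sqr_ge0//.
  by rewrite (le_lt_trans intQ) ?ltry.
have {}intQ : \int[m]_w (Q w ^+ 2) <= k ^+ 2 * t ^+ 2.
  by rewrite -lee_fin /Rintegral fineK ?integrable_fin_num.
have iS : integrableR P (fun w => \1_D w * S w j 0).
  apply: integrableR_le (integrable_norm (square_integrable_integrable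
    (conj sS S2 : square_integrable P (fun w => S w j 0)))).
    exact: measurable_funM.
  move=> w; have /andP[? ?] := i01 w.
  by rewrite normrM (ger0_norm (x := \1_D w))// ler_piMl.
have iSp : integrableR m (fun w => \1_D w * S w j 0 * p c0 w).
  by apply/(density_integrableP (mp c0) (p_ge0 c0) Pp) => //; exact: measurable_funM.
have iS2p : integrableR m (fun w => S w j 0 ^+ 2 * p c0 w).
  by apply/(density_integrableP (mp c0) (p_ge0 c0) Pp) => //; exact: measurable_funX.
have iD c : integrableR m (fun w => \1_D w * p c w).
  apply: integrableR_le (ip c); first exact: measurable_funM.
  move=> w; have /andP[? ?] := i01 w.
  by rewrite normrM (ger0_norm (x := \1_D w))// (ger0_norm (p_ge0 c w)) ler_piMl.
have -> : t * `|\int[P]_w (\1_D w * S w j 0)| =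
    `|\int[m]_w (t * (\1_D w * S w j 0 * p c0 w) -
      (\1_D w * p (c0 + h) w - \1_D w * p c0 w))|.
  rewrite RintegralB//; [|exact: integrableRZ|exact: integrableRB].
  rewrite (RintegralB measurableT (iD _) (iD _)) pD subrr subr0.
  rewrite (RintegralZl _ measurableT iSp).
  by rewrite -(density_Rintegral (mp c0) (p_ge0 c0) Pp iS) normrM (gtr0_norm t0).
apply: le_trans (le_normr_Rintegral _ _) _ => //.
  by apply: integrableRB; [exact: integrableRZ|exact: integrableRB].
apply: (@le_trans _ _ (\int[m]_w (k * t * p c0 w + ((k * t)^-1 + 2) * Q w ^+ 2 +
    2^-1 * t ^+ 2 * (S w j 0 ^+ 2 * p c0 w)))).
  apply: le_Rintegral => //.
  - apply: integrable_norm; apply: integrableRB; first exact: integrableRZ.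
    exact: integrableRB.
  - by do 2 (apply: integrableRD; last exact: integrableRZ); exact: integrableRZ.
  - move=> w _; have := pointwise (S w j 0) (Num.sqrt (p (c0 + h) w))
      (Num.sqrt (p c0 w)) t0 k0 (i01 w).
    by rewrite !sqr_sqrtr.
rewrite RintegralD//; [|by apply: integrableRD; exact: integrableRZ|exact: integrableRZ].
rewrite RintegralD//; [|exact: integrableRZ|exact: integrableRZ].
rewrite (RintegralZl _ measurableT (ip c0)) (RintegralZl _ measurableT iQ).
rewrite (RintegralZl _ measurableT iS2p).
rewrite (density_Rintegral (mp c0) (p_ge0 c0) Pp S2).
have -> : \int[m]_w p c0 w = 1.
  by rewrite /Rintegral -Pp// probability_setT.
have kt0 : 0 < k * t by rewrite mulr_gt0.
have : ((k * t)^-1 + 2) * \int[m]_w (Q w ^+ 2) <= ((k * t)^-1 + 2) * (k ^+ 2 * t ^+ 2).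
  by rewrite ler_wpM2l// addr_ge0// invr_ge0 ltW.
have -> : ((k * t)^-1 + 2) * (k ^+ 2 * t ^+ 2) = k * t + 2 * k ^+ 2 * t ^+ 2.
  by field; rewrite !gt_eqF.
lra.
Qed.

(** After division by t, the bound of [small_step] is 2k + t W, with k arbitrary and then t as small
    as desired. *)
Lemma score_mean_zero j : \int[P]_w (\1_D w * S w j 0) = 0.
Proof.
set I := \int[P]_w _; apply/eqP; rewrite -normr_le0; apply/ler_addgt0Pl => e e0.
rewrite addr0; pose k := e / 4; have k0 : 0 < k by rewrite divr_gt0.
have [del del0 hdel] := small_step j k0.
set W := _ + 2 * k ^+ 2 in hdel.
have W0 : 0 <= W.
  by rewrite /W addr_ge0// mulr_ge0// ?sqr_ge0// Rintegral_sqr_ge0.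
(* The first two bounds give t^2 <= t < del; the third gives t W <= k, so the total is at most 3k <=
   e. *)
pose t := Num.min (Num.min 1 (del / 2)) (k / (W + 1)).
have W1 : 0 < W + 1 by lra.
have t0 : 0 < t by rewrite !lt_min ltr01 !divr_gt0.
have t1 : t <= 1 by rewrite !ge_min lexx.
have t2 : t <= del / 2 by rewrite !ge_min lexx orbT.
have t3 : t * (W + 1) <= k by rewrite -ler_pdivlMr// !ge_min lexx !orbT.
have td : t ^+ 2 < del.
  by apply: (@le_lt_trans _ _ t); [rewrite expr2 ler_piMl// ltW|lra].
have := hdel t t0 td; rewrite -/I.
have -> : 2 * k * t + t ^+ 2 * W = t * (2 * k + t * W) by ring.
rewrite ler_pM2l// => /le_trans; apply.
have : t * W <= k by nra.
rewrite /k; lra.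
Qed.

End score_mean_zero.

(** * Limits of difference quotients, truncation and bounded approximation *)

Section limits.
Context (R : realType).

(** Steps 1/(n+1) leave countably many difference quotients, so that measurability survives the
    passage to the limit. *)
Lemma is_derive_seq (f : R -> R) (l : R) : is_derive (0 : R) (1 : R) f l ->
  n.+1%:R * (f n.+1%:R^-1 - f 0) @[n --> \oo] --> l.
Proof.
move=> [fd <-]; have : h^-1 *: ((f \o shift 0) (h *: 1) - f 0) @[h --> 0^'] --> 'D_1 f 0.
  exact: fd.
move=> /(cvgr_dnbhsP _ _ _).1 /(_ (@harmonic R)); rewrite /harmonic => h.
have : (fun n => (n.+1%:R^-1)^-1 *: ((f \o shift 0) (n.+1%:R^-1 *: 1) - f 0))
    @ \oo --> 'D_1 f 0.
  by apply: h; split; [move=> n; rewrite invr_neq0|exact: cvg_harmonic].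
by under eq_fun do rewrite /= addr0 invrK scaler1.
Qed.

Lemma near_harmonic (Q : R -> Prop) : (\forall t \near (0 : R), Q t) ->
  \forall n \near \oo, Q n.+1%:R^-1.
Proof. by move=> h; exact: (@cvg_harmonic R _ h). Qed.

(** The limit superior of the D_n is a measurable function on all of U, and it agrees with the limit
    wherever that exists. *)
Lemma limit_factor d d' (T : measurableType d) (U : measurableType d')
    (P : probability T R) (Z : T -> U) (D : nat -> U -> R) (S : T -> R) :
  (forall n, measurable_fun setT (D n)) ->
  {ae P, forall w, D n (Z w) @[n --> \oo] --> S w} ->
  exists2 u : U -> R, measurable_fun setT u & {ae P, forall w, S w = u (Z w)}.
Proof.
move=> mD DS; exists (fun x => fine (limn_esup (fun n => (D n x)%:E))).
  apply: measurableT_comp => //; apply: measurable_fun_limn_esup => n.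
  exact/measurable_EFinP.
apply: filterS DS => w h.
have /cvg_limn_einf_sup[_ ->]// : (D n (Z w))%:E @[n --> \oo] --> (S w)%:E.
by apply/fine_cvgP; split; first exact: nearW.
Qed.

Definition truncate (k x : R) : R := Num.max (- k) (Num.min x k).

Lemma truncate_lipschitz k x y : `|truncate k x - truncate k y| <= `|x - y|.
Proof.
rewrite /truncate; case: (leP x k) => xk; case: (leP y k) => yk;
  case: (leP (- k) x) => ?; case: (leP (- k) y) => ?; case: (leP (- k) k) => ?;
  rewrite ler_norml;
  have := ler_norm (x - y); have := ler_norm (- (x - y)); rewrite normrN => ? ?;
  apply/andP; split; lra.
Qed.

Lemma truncate_bound k x : 0 <= k -> `|truncate k x| <= k.
Proof.
move=> k0; rewrite /truncate ler_norml; case: (leP x k) => xk; case: (leP (- k) x) => ?;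
  case: (leP (- k) k) => ?; apply/andP; split; lra.
Qed.

Lemma truncate_id k x : `|x| <= k -> truncate k x = x.
Proof.
rewrite ler_norml => /andP[a c]; rewrite /truncate.
by rewrite (_ : Num.min x k = x) ?max_r//; exact/min_idPl.
Qed.

Lemma truncate_le k x : 0 <= k -> `|truncate k x| <= `|x|.
Proof.
move=> k0; have z : truncate k 0 = 0 by rewrite truncate_id ?normr0.
by have := truncate_lipschitz k x 0; rewrite z !subr0.
Qed.

Lemma measurable_truncate d (T : measurableType d) (f : T -> R) k :
  measurable_fun setT f -> measurable_fun setT (fun w => truncate k (f w)).
Proof.
move=> mf; apply: (measurable_maxr (f := fun=> - k)); first exact: measurable_cst.
by apply: (measurable_minr (g := fun=> k)) => //; exact: measurable_cst.
Qed.

Lemma truncate_cvg x : truncate n%:R x @[n --> \oo] --> x.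
Proof.
apply: cvg_near_cst; near=> n; apply: truncate_id; near: n.
exact: nbhs_infty_ger.
Unshelve. all: by end_near. Qed.

(* [s] and [n] need not be integrable separately: truncation is 1-Lipschitz, so
   the truncated difference is dominated by the difference. *)
Lemma orth_difference d dY dX (T : measurableType d) (U : measurableType dY)
    (V : measurableType dX) (P : probability T R) (Y : T -> U) (X : T -> V)
    (f S : T -> R) (s : U -> R) (n : V -> R) :
  measurable_fun setT Y -> measurable_fun setT X ->
  measurable_fun setT s -> measurable_fun setT n ->
  square_integrable P f -> square_integrable P S ->
  {ae P, forall w, S w = s (Y w) - n (X w)} ->
  (forall u : U -> R, measurable_fun setT u -> square_integrable P (u \o Y) ->
    \int[P]_w (f w * u (Y w)) = 0) ->
  (forall v : V -> R, measurable_fun setT v -> square_integrable P (v \o X) ->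
    \int[P]_w (f w * v (X w)) = 0) ->
  \int[P]_w (f w * S w) = 0.
Proof.
move=> mY mX ms mn sf sS SE fY fX; pose S' w := s (Y w) - n (X w).
have mS' : measurable_fun setT S' by apply: measurable_funB; exact: measurableT_comp.
have sS' : square_integrable P S' by exact: ae_square_integrable mS' SE sS.
have [mf _] := sf; have [mS _] := sS.
have -> : \int[P]_w (f w * S w) = \int[P]_w (f w * S' w).
  apply: ae_eq_Rintegral; [exact: measurable_funM|exact: measurable_funM|].
  by apply: filterS SE => w ->.
have mt k : measurable_fun setT (fun w => truncate k (s (Y w))).
  by apply: measurable_truncate; exact: measurableT_comp.
have mt' k : measurable_fun setT (fun w => truncate k (n (X w))).
  by apply: measurable_truncate; exact: measurableT_comp.
have : \int[P]_w (f w * (truncate k%:R (s (Y w)) - truncate k%:R (n (X w))))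
    @[k --> \oo] --> \int[P]_w (f w * S' w).
  apply: (dominated_convergenceR (g := fun w => `|f w * S' w|)).
  - by move=> k; apply: measurable_funM => //; exact: measurable_funB.
  - exact: measurable_funM.
  - by apply: aeW => w; apply: cvgMr; apply: cvgB; exact: truncate_cvg.
  - exact: integrable_norm (square_integrableM sf sS').
  - by move=> k w; rewrite !normrM ler_wpM2l// truncate_lipschitz.
rewrite (_ : (fun k => _) = (fun=> 0)).
  by move=> /(cvg_unique _ (cvg_cst (0 : R))) <-.
apply/funext => k.
have sY : square_integrable P (fun w => truncate k%:R (s (Y w))).
  by apply: (@bounded_square_integrable _ _ _ _ k%:R) => // w; exact: truncate_bound.
have sX : square_integrable P (fun w => truncate k%:R (n (X w))).
  by apply: (@bounded_square_integrable _ _ _ _ k%:R) => // w; exact: truncate_bound.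
transitivity (\int[P]_w (f w * truncate k%:R (s (Y w)) - f w * truncate k%:R (n (X w)))).
  by apply: eq_Rintegral => w _; rewrite mulrBr.
rewrite (RintegralB measurableT (square_integrableM sf sY) (square_integrableM sf sX)).
rewrite (fY (fun y => truncate k%:R (s y)))//; last exact: measurable_truncate.
by rewrite (fX (fun x => truncate k%:R (n x)))// ?subrr//; exact: measurable_truncate.
Qed.

(** Truncate u, then subtract the mean c of the truncation, which tends to the mean 0 of u. The
    squared error is at most 2 (e/4) + 2 c^2, and c^2 < e/4 too. *)
Lemma bounded_dense d d' (T : measurableType d) (U : measurableType d')
    (P : probability T R) (Z : T -> U) (u : U -> R) (e : R) :
  measurable_fun setT Z -> measurable_fun setT u -> square_integrable P (u \o Z) ->
  \int[P]_w u (Z w) = 0 -> 0 < e ->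
  exists M (v : U -> R), [/\ 0 <= M, measurable_fun setT v, forall z, `|v z| <= M,
    \int[P]_w v (Z w) = 0 & \int[P]_w ((u (Z w) - v (Z w)) ^+ 2) < e].
Proof.
move=> mZ mu su u0 e0; have [muZ su2] := su.
have mt k : measurable_fun setT (fun w => truncate k (u (Z w))).
  exact: measurable_truncate.
have h1 : \int[P]_w ((u (Z w) - truncate k%:R (u (Z w))) ^+ 2) @[k --> \oo] -->
    \int[P]_w (0 : R).
  apply: (dominated_convergenceR (g := fun w => 4 * u (Z w) ^+ 2)).
  - by move=> k; apply: measurable_funX; exact: measurable_funB.
  - exact: measurable_cst.
  - apply: aeW => w; apply: cvg_near_cst; near=> k.
    rewrite truncate_id ?subrr ?expr0n//; near: k; exact: nbhs_infty_ger.
  - exact: integrableRZ su2.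
  - move=> k w; rewrite ger0_norm ?sqr_ge0//.
    have aux (x y : R) : `|x| <= `|y| -> (y - x) ^+ 2 <= 4 * y ^+ 2.
      move=> xy; have : `|y - x| <= 2 * `|y| by have := ler_normB y x; lra.
      rewrite -[(y - x) ^+ 2]real_normK ?num_real// -[y ^+ 2]real_normK ?num_real//.
      have := normr_ge0 (y - x); nra.
    exact/aux/truncate_le.
have h2 : \int[P]_w truncate k%:R (u (Z w)) @[k --> \oo] --> \int[P]_w u (Z w).
  apply: (dominated_convergenceR (g := fun w => `|u (Z w)|)) => //.
  - by apply: aeW => w; exact: truncate_cvg.
  - exact: integrable_norm (square_integrable_integrable su).
  - by move=> k w; exact: truncate_le.
rewrite u0 in h2; rewrite {2}/Rintegral integral0 /= in h1.
have e4 : 0 < e / 4 by rewrite divr_gt0.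
have h3 : (\int[P]_w truncate k%:R (u (Z w))) * (\int[P]_w truncate k%:R (u (Z w)))
    @[k --> \oo] --> (0 * 0 : R) by apply: cvgM; exact: h2.
rewrite mulr0 in h3.
have [k [k1 k2]] : exists k : nat,
    \int[P]_w ((u (Z w) - truncate k%:R (u (Z w))) ^+ 2) < e / 4 /\
    (\int[P]_w truncate k%:R (u (Z w))) ^+ 2 < e / 4.
  move: h1 h3 => /cvgr_lt/(_ _ e4) a1 /cvgr_lt/(_ _ e4) a2.
  by have [k _ hk] := filterI a1 a2; exists k; have [] := hk k (leqnn k).
set c := \int[P]_w _ in k2.
exists (k%:R + `|c|), (fun z => truncate k%:R (u z) - c); split.
- by rewrite addr_ge0.
- by apply: measurable_funB => //; exact: measurable_truncate.
- move=> z; apply: (le_trans (ler_normB _ _)); rewrite lerD2r.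
  exact: truncate_bound.
- have st : integrableR P (fun w => truncate k%:R (u (Z w))).
    by apply: (@bounded_integrableR _ _ _ _ k%:R) => // w; exact: truncate_bound.
  have ic : integrableR P (fun=> c).
    exact: (finite_measure_integrable_cst P c measurableT).
  by rewrite (RintegralB measurableT st ic) Rintegral_probability_cst subrr.
have st : square_integrable P (fun w => truncate k%:R (u (Z w))).
  by apply: (@bounded_square_integrable _ _ _ _ k%:R) => // w; exact: truncate_bound.
have sc : square_integrable P (fun=> c).
  by apply: (@bounded_square_integrable _ _ _ _ `|c|) => //; exact: measurable_cst.
have := Rintegral_sqrD_le (square_integrableB su st) sc.
rewrite Rintegral_probability_cst => h.
have -> : \int[P]_w ((u (Z w) - (truncate k%:R (u (Z w)) - c)) ^+ 2) =
  \int[P]_w ((u (Z w) - truncate k%:R (u (Z w)) + c) ^+ 2).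
  by apply: eq_Rintegral => w _; rewrite opprB addrA addrAC.
by apply: le_lt_trans h _; lra.
Unshelve. all: by end_near. Qed.

End limits.

(** * Structure of the nuisance scores *)

Section score_structure.
Context (R : realType) (q : nat).
Variables (nu : {sigma_finite_measure set R -> \bar R})
  (mu : {sigma_finite_measure set (q.-tuple R) -> \bar R}).
Variables (b : 'cV[R]_q) (g : R -> R) (eta : q.-tuple R -> R).
Variable P : probability (R * q.-tuple R)%type R.
Hypotheses (hm : plr_model nu mu b g eta) (hl : plr_law nu mu b g eta P).

Let mp := model_measurable_dens hm.
Let p0 := model_dens_ge0 hm.

Let mulr_gt0_inv (x y : R) : 0 <= x -> 0 <= y -> 0 < x * y -> 0 < x /\ 0 < y.
Proof.
by move=> x0 y0 /gt_eqF/negbT; rewrite mulf_eq0 negb_or !lt_def x0 y0 !andbT => /andP[].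
Qed.

(** A density of total mass 1 is not almost everywhere 0, so the set where it is positive meets
    every set of full measure. *)
Let eta_gt0_exists (Q : q.-tuple R -> Prop) : {ae mu, forall x, Q x} ->
  exists x, 0 < eta x /\ Q x.
Proof.
move=> Qx; have [_ [me e0 e1] _] := hm; apply: contrapT => h.
have : {ae mu, forall x, (eta x)%:E = 0%E :> \bar R}.
  apply: filterS Qx => x qx; congr EFin; apply/eqP; apply: contrapT => ex.
  by apply: h; exists x; split => //; rewrite lt_def e0 andbT; apply/negP.
move=> ae0; have := e1; rewrite (ae_eq_integral (cst 0%E)) //; last 2 first.
- exact/measurable_EFinP.
- by apply: filterS ae0 => x.
by rewrite integral0 => /esym/eqP; rewrite onee_eq0.
Qed.

(** For an x0 with eta(x0) > 0 and finite normaliser, the density in y is a positive multiple of g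
    at each y, so almost every such slice of a null set is null for g dnu. A set of y null for g dnu
    is null under the law of Y as well, whatever x accompanies it. *)
Lemma ae_slice (Q : R * q.-tuple R -> Prop) : {ae P, forall w, Q w} ->
  exists x0, {ae P, forall w, Q (w.1, x0)}.
Proof.
move=> [N [mN PN0 QN]].
have [hg _ fin] := hm; have [mg g0 _] := hg.
pose F (z : R * q.-tuple R) : \bar R := (\1_N z * plr_dens nu b g eta z)%:E.
have m1 : measurable_fun setT (\1_N : R * q.-tuple R -> R) by exact: measurable_indic.
have mF : measurable_fun setT F.
  by apply/measurable_EFinP; apply: measurable_funM; [exact: m1|exact: mp].
have F0 z : (0 <= F z)%E by rewrite lee_fin mulr_ge0// indicE.
have int_preimage (N' : set (R * q.-tuple R)) : measurable N' ->
    P N' = (\int[nu \x mu]_z (\1_N' z * plr_dens nu b g eta z)%:E)%E.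
  move=> mN'; rewrite (hl mN') integral_mkcond; apply: eq_integral => z _.
  by rewrite patchE indicE; case: (z \in N'); rewrite ?mul1r ?mul0r.
have I0 : {ae mu, forall x, (\int[nu]_y F (y, x) = 0)%E}.
  have IF : (\int[mu]_x \int[nu]_y F (y, x) = 0)%E.
    by rewrite -PN0 int_preimage// (fubini_tonelli2 F mF F0).
  have mI : measurable_fun setT (fun x => \int[nu]_y F (y, x))%E.
    exact: (measurable_fun_fubini_tonelli_G F mF F0).
  have : (\int[mu]_x `|\int[nu]_y F (y, x)| = 0)%E.
    rewrite -[RHS]IF; apply: eq_integral => x _; rewrite gee0_abs//.
    exact: integral_ge0.
  by move=> /(ae_eq_integral_abs mu measurableT mI).1; apply: filterS => x; apply.
have [x0 [ex0 [Nx0 Ix0]]] : exists x, 0 < eta x /\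
    ((plr_norm nu b g x < +oo)%E /\ (\int[nu]_y F (y, x) = 0)%E).
  have [x [ex [h1 h2]]] := eta_gt0_exists (filterI fin I0).
  by exists x; split=> //; split => //; exact: h1.
have Fy : {ae nu, forall y, \1_N (y, x0) * g y = 0 :> R}.
  have mFx : measurable_fun setT (fun y => F (y, x0)) by exact: (measurable_fun_pair1 x0 mF).
  have : (\int[nu]_y `|F (y, x0)| = 0)%E.
    by rewrite -[RHS]Ix0; apply: eq_integral => y _; rewrite gee0_abs.
  move=> /(ae_eq_integral_abs nu measurableT mFx).1; apply: filterS => y /(_ I) [].
  rewrite /plr_dens/=.
  have -> : \1_N (y, x0) * (expR (dotv b (vec_of_tuple x0) * y) * g y /
      fine (plr_norm nu b g x0) * eta x0) =
      (\1_N (y, x0) * g y) * (expR (dotv b (vec_of_tuple x0) * y) /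
      fine (plr_norm nu b g x0) * eta x0) by ring.
  move/eqP; rewrite mulf_eq0 => /orP[/eqP//|].
  by rewrite gt_eqF// mulr_gt0// divr_gt0 ?expR_gt0// fine_plr_norm_gt0.
exists x0; pose N' : set (R * q.-tuple R) := (fun w => (w.1, x0)) @^-1` N.
have mN' : measurable N'.
  rewrite -[X in measurable X]setTI.
  have : measurable_fun setT (fun w : R * q.-tuple R => (w.1, x0)).
    by apply: measurable_fun_pair; [exact: measurable_fst|exact: measurable_cst].
  exact.
exists N'; split => //; last by move=> w /= h; apply: QN.
have m1' : measurable_fun setT (\1_N' : R * q.-tuple R -> R) by exact: measurable_indic.
rewrite int_preimage// fubini_tonelli2; first last.
- by move=> z; rewrite lee_fin mulr_ge0// indicE.
- by apply/measurable_EFinP; apply: measurable_funM; [exact: m1'|exact: mp].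
(* On every fibre the integrand is a multiple of the indicator of N at (y, x0) times g(y), which
   vanishes nu-almost everywhere by [Fy]. *)
apply: integral0_eq => x _; rewrite /fubini_G.
rewrite (ae_eq_integral (cst 0%E))//; first by rewrite integral0.
- apply/measurable_EFinP.
  have mm : measurable_fun setT (fun z : R * q.-tuple R => \1_N' z * plr_dens nu b g eta z).
    by apply: measurable_funM; [exact: m1'|exact: mp].
  exact: (measurable_fun_pair1 x mm).
- apply: filterS Fy => y Fy _; congr EFin; rewrite /plr_dens/=.
  have -> : \1_N' (y, x) = \1_N (y, x0) :> R by rewrite !indicE; congr (nat_of_bool _)%:R;
    apply/idP/idP; rewrite !inE.
  by rewrite -[RHS](mul0r (expR (dotv b (vec_of_tuple x) * y) /
      fine (plr_norm nu b g x) * eta x)) -Fy; ring.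
Qed.

Section eta_scores.
Variables (r : nat) (ef : 'cV[R]_r -> q.-tuple R -> R) (c0 : 'cV[R]_r).
Variable S : R * q.-tuple R -> 'cV[R]_r.
Hypotheses (ef_model : forall c, plr_model nu mu b g (ef c))
  (hS : is_score (nu \x mu)%E P (fun c => plr_dens nu b g (ef c)) c0 S).

(** In the difference quotient of the log-density the conditional density of Y given X cancels,
    leaving a quotient in x alone; [limit_factor] supplies the limit. *)
Lemma eta_score_factor j : exists2 u : q.-tuple R -> R, measurable_fun setT u &
  {ae P, forall w, S w j 0 = u w.2}.
Proof.
pose et (t : R) := ef (c0 + t *: delta_mx j 0).
pose D n x := n.+1%:R * (ln (et n.+1%:R^-1 x) - ln (et 0 x)).
have met t : measurable_fun setT (et t).
  by have [_ [+ _ _] _] := ef_model (c0 + t *: delta_mx j 0).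
have et0 t x : 0 <= et t x.
  by have [_ [_ + _] _] := ef_model (c0 + t *: delta_mx j 0); apply.
apply: (@limit_factor _ _ _ _ _ P snd D).
  move=> n; apply: measurable_funM => //; apply: measurable_funB.
    exact: measurableT_comp (@measurable_ln R) (met _).
  exact: measurableT_comp (@measurable_ln R) (met _).
have [[_ g0 _] _ _] := hm.
have [+ _ _ _ _] := hS; move=> /(_ j); apply: filterS => w [pos der].
have lnp t : 0 < plr_dens nu b g (et t) w ->
    ln (plr_dens nu b g (et t) w) =
    ln (expR (dotv b (vec_of_tuple w.2) * w.1) * g w.1 / fine (plr_norm nu b g w.2))
    + ln (et t w.2).
  rewrite /plr_dens => /mulr_gt0_inv [||k0 e0]; last by rewrite lnM.
  - by rewrite divr_ge0 ?fine_ge0 ?plr_norm_ge0// mulr_ge0 ?expR_ge0.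
  - exact: et0.
have pos0 : 0 < plr_dens nu b g (et 0) w by exact: nbhs_singleton pos.
apply: cvg_trans (is_derive_seq der); apply: near_eq_cvg.
have := near_harmonic pos; apply: filterS => n posn.
by rewrite /D !lnp//; congr (_ * _); ring.
Qed.

End eta_scores.

Section g_scores.
Variables (r : nat) (gf : 'cV[R]_r -> R -> R) (c0 : 'cV[R]_r).
Variable S : R * q.-tuple R -> 'cV[R]_r.
Hypotheses (gf_c0 : gf c0 = g) (gf_model : forall c, plr_model nu mu b (gf c) eta)
  (hS : is_score (nu \x mu)%E P (fun c => plr_dens nu b (gf c) eta) c0 S).

Let hl0 : forall A, measurable A ->
  P A = (\int[(nu \x mu)%E]_(w in A) (plr_dens nu b (gf c0) eta w)%:E)%E.
Proof. by rewrite gf_c0. Qed.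

Let mdens c : measurable_fun setT (plr_dens nu b (gf c) eta).
Proof. exact: (model_measurable_dens (gf_model c)). Qed.

Let dens_ge0 c z : 0 <= plr_dens nu b (gf c) eta z.
Proof. exact: (model_dens_ge0 (gf_model c)). Qed.

Lemma g_score_square_integrable j : square_integrable P (fun w => S w j 0).
Proof. exact: (score_square_integrable hS). Qed.

(* A single good [x0] turns convergence of the sum A_n(y) - B_n(x) of the two
   difference quotients into convergence of A_n(y) - B_n(x0) and of
   B_n(x) - B_n(x0); neither A_n nor B_n needs to converge. *)
Lemma g_score_difference j : exists (s : R -> R) (n : q.-tuple R -> R),
  [/\ measurable_fun setT s, measurable_fun setT n &
      {ae P, forall w, S w j 0 = s w.1 - n w.2}].
Proof.
pose gt (t : R) := gf (c0 + t *: delta_mx j 0).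
have gt_dens t : is_density nu (gt t) by have [] := gf_model (c0 + t *: delta_mx j 0).
have mgt t : measurable_fun setT (gt t) by have [] := gt_dens t.
have gt_ge0 t y : 0 <= gt t y by have [_ + _] := gt_dens t; apply.
pose A n y := n.+1%:R * (ln (gt n.+1%:R^-1 y) - ln (gt 0 y)).
pose N t x := fine (plr_norm nu b (gt t) x).
pose B n x := n.+1%:R * (ln (N n.+1%:R^-1 x) - ln (N 0 x)).
have mN t : measurable_fun setT (N t) by exact: measurable_fine_plr_norm.
have mB n : measurable_fun setT (B n).
  apply: measurable_funM => //; apply: measurable_funB.
    exact: measurableT_comp (@measurable_ln R) (mN _).
  exact: measurableT_comp (@measurable_ln R) (mN _).
have lnp t w : 0 < plr_dens nu b (gt t) eta w ->
    ln (plr_dens nu b (gt t) eta w) =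
    dotv b (vec_of_tuple w.2) * w.1 + ln (gt t w.1) - ln (N t w.2) + ln (eta w.2).
  have [_ [_ e0 _] _] := hm.
  rewrite /plr_dens => /mulr_gt0_inv [||k0 ez].
  - by rewrite divr_ge0 ?fine_ge0 ?plr_norm_ge0// mulr_ge0 ?expR_ge0.
  - exact: e0.
  have [eg0 N0] : 0 < expR (dotv b (vec_of_tuple w.2) * w.1) * gt t w.1 /\ 0 < N t w.2.
    have [||? ?] := mulr_gt0_inv _ _ k0.
    - by rewrite mulr_ge0 ?expR_ge0.
    - by rewrite invr_ge0 fine_ge0// plr_norm_ge0.
    by split=> //; rewrite -invr_gt0.
  have g0 : 0 < gt t w.1.
    by rewrite -(pmulr_rgt0 _ (expR_gt0 (dotv b (vec_of_tuple w.2) * w.1))).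
  by rewrite lnM// ln_div// lnM ?posrE ?expR_gt0// expRK.
have AB : {ae P, forall w, A n w.1 - B n w.2 @[n --> \oo] --> S w j 0}.
  have [+ _ _ _ _] := hS; move=> /(_ j); apply: filterS => w [pos der].
  have pos0 : 0 < plr_dens nu b (gt 0) eta w by exact: nbhs_singleton pos.
  apply: cvg_trans (is_derive_seq der); apply: near_eq_cvg.
  have := near_harmonic pos; apply: filterS => n posn.
  by rewrite /A /B !lnp//; ring.
have [x0 Ax0] := ae_slice AB.
have [mS _] := g_score_square_integrable j.
(* The limit of A_n(y) - B_n(x0) is S(y, x0) itself, so a section of the score serves as s. *)
have ms : measurable_fun setT (fun y => S (y, x0) j 0).
  exact: (measurable_fun_pair1 x0 mS).
have [n mn nE] : exists2 n : q.-tuple R -> R, measurable_fun setT n &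
    {ae P, forall w, S (w.1, x0) j 0 - S w j 0 = n w.2}.
  apply: (@limit_factor _ _ _ _ _ P snd (fun n x => B n x - B n x0)).
    by move=> n; apply: measurable_funB => //; exact: measurable_cst.
  apply: filterS2 AB Ax0 => w h1 h2.
  rewrite (_ : (fun n => B n w.2 - B n x0) =
    (fun n => (A n w.1 - B n x0) - (A n w.1 - B n w.2))); first exact: cvgB.
  by apply/funext => n; rewrite opprB [RHS]addrC addrA subrK.
exists (fun y => S (y, x0) j 0), n; split=> //.
by apply: filterS nE => w <-; rewrite opprB addrC subrK.
Qed.

(** [score_mean_zero] applied to the events {X in B}, whose probability is the integral of [eta]
    over B for every parameter value. *)
Lemma g_score_condE0 j : is_condE P snd (fun w => S w j 0) (fun=> 0).
Proof.
split; first exact: measurable_cst.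
  exact: (finite_measure_integrable_cst P 0 measurableT).
move=> B mB; pose D : set (R * q.-tuple R) := snd @^-1` B.
have mD : measurable D.
  by rewrite -[X in measurable X]setTI; exact: measurable_snd.
have ip c : integrableR (nu \x mu)%E (plr_dens nu b (gf c) eta).
  apply/integrableP; split; first by apply/measurable_EFinP; exact: mdens.
  under eq_integral do rewrite /= ger0_norm//.
  have [_ [_ _ e1] _] := hm.
  rewrite (eq_integral (fun z : R * q.-tuple R =>
    (cst 1%E z.2 * (plr_dens nu b (gf c) eta z)%:E)%E)); last first.
    by move=> z _; rewrite /= mul1e.
  rewrite (plr_dens_marginal (u := cst 1%E) (gf_model c))//.
  by under eq_integral do rewrite /= mul1e; rewrite e1 ltry.
have iB : measurable_fun setT (fun x : q.-tuple R => (\1_B x)%:E : \bar R).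
  by apply/measurable_EFinP; exact: measurable_indic.
have pD c : \int[(nu \x mu)%E]_w (\1_D w * plr_dens nu b (gf c) eta w) =
    fine (\int[mu]_x ((\1_B x)%:E * (eta x)%:E))%E.
  rewrite -(plr_dens_marginal (gf_model c) iB); last by move=> x; rewrite lee_fin indicE.
  congr fine; apply: eq_integral => z _; rewrite -EFinM (_ : \1_D z = \1_B z.2)//.
have := score_mean_zero mdens dens_ge0 ip hl0 hS mD _ j.
rewrite integral0 => h.
have [mS _] := g_score_square_integrable j.
have iS : P.-integrable D (EFin \o (fun w => S w j 0)).
  apply: (integrableS measurableT) => //.
  exact: (square_integrable_integrable (g_score_square_integrable j)).
rewrite -[LHS]fineK ?integrable_fin_num//; congr EFin.
rewrite -/(Rintegral P D (fun w => S w j 0)) Rintegral_mkcond -[RHS]h.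
  apply: eq_Rintegral => w _; rewrite patchE indicE.
  by case: (w \in D); rewrite ?mul1r ?mul0r.
by move=> c; rewrite !pD.
Qed.

End g_scores.
End score_structure.

(** * Projections *)

Section hilbert_space_lemmas.
Context d (T : measurableType d) (R : realType).
Variable P : probability T R.
Variable q : nat.
Implicit Types a b c : T -> 'cV[R]_q.

Definition sq_components a := forall i, square_integrable P (fun w => a w i 0).

Lemma Hspace_square_integrable a : Hspace P a -> sq_components a.
Proof.
move=> [ma a2 _] i; split=> //; apply/integrableP; split.
  by apply/measurable_EFinP; exact: measurable_funX.
have := a2 i; rewrite unlock; apply: le_lt_trans.
by under eq_integral do rewrite /= ger0_norm ?sqr_ge0//.
Qed.

Lemma Hspace_mean a i : Hspace P a -> \int[P]_w a w i 0 = 0.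
Proof. by move=> [_ _ /(_ i)]; rewrite unlock /Rintegral => ->. Qed.

Lemma HspaceI a : sq_components a -> (forall i, \int[P]_w a w i 0 = 0) -> Hspace P a.
Proof.
move=> sa a0; split=> i; have [ma a2] := sa i; rewrite ?unlock//.
  exact: integrable_lty a2.
by rewrite -[LHS]fineK ?integrable_fin_num//;
  [congr EFin; exact: a0|exact: (square_integrable_integrable (sa i))].
Qed.

Lemma innerE a b : sq_components a -> sq_components b ->
  inner P a b = (\sum_i \int[P]_w (a w i 0 * b w i 0))%:E.
Proof.
move=> sa sb; have iab i := square_integrableM (sa i) (sb i).
rewrite /inner unlock -Rintegral_sum// /Rintegral fineK.
  by apply: eq_integral => w _; rewrite dotvE.
by apply: integrable_fin_num => //; exact: (integrableR_sum _ iab).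
Qed.

Lemma sq_componentsB a b : sq_components a -> sq_components b ->
  sq_components (a \- b).
Proof.
move=> sa sb i; apply: square_integrable_eq (square_integrableB (sa i) (sb i)).
by move=> w; rewrite !mxE.
Qed.

Lemma ms_closureI (A : set (T -> 'cV[R]_q)) b : Hspace P b ->
  (forall e : R, 0 < e -> exists c, [/\ A c, sq_components c &
     forall i, \int[P]_w ((b w i 0 - c w i 0) ^+ 2) <= e]) ->
  ms_closure P A b.
Proof.
move=> hb happ; split=> // e e0.
(* The error is shared among q components; the extra 1 makes the total strictly less than e and
   covers q = 0. *)
have e0' : 0 < e / (q%:R + 1) by rewrite divr_gt0// ltr_pwDr.
have [c [Ac sc bc]] := happ _ e0'; exists c => //.
have sbc := sq_componentsB (Hspace_square_integrable hb) sc.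
rewrite innerE// lte_fin; apply: (@le_lt_trans _ _ (\sum_(i < q) e / (q%:R + 1))).
  apply: ler_sum => i _; apply: le_trans (bc i); rewrite le_eqVlt; apply/orP; left.
  by apply/eqP/eq_Rintegral => w _; rewrite !mxE expr2.
rewrite sumr_const card_ord -[X in X < _]mulr_natr mulrAC.
by rewrite ltr_pdivrMr ?ltr_pwDr// ltr_pM2l// ltrDl.
Qed.

(** Subtracting an approximating c' from c leaves the inner product unchanged. With V the second
    moment of a, AM-GM with weight k = e / (V + 1) and squared distance below k^2 bounds it by kV +
    k = e. *)
Lemma ms_closure_orth (A : set (T -> 'cV[R]_q)) a : sq_components a ->
  (forall c, A c -> sq_components c /\
     forall i, \int[P]_w (a w i 0 * c w i 0) = 0) ->
  forall c, ms_closure P A c -> inner P a c = 0%E.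
Proof.
move=> sa orth c [hc happ]; have sc := Hspace_square_integrable hc.
rewrite innerE//; congr EFin; apply/eqP; rewrite -normr_le0.
apply/ler_addgt0Pl => e e0; rewrite addr0.
set V := \sum_i \int[P]_w (a w i 0 ^+ 2).
have V0 : 0 <= V by apply: sumr_ge0 => i _; exact: Rintegral_sqr_ge0.
pose k := e / (V + 1); have V1 : 0 < V + 1 by lra.
have k0 : 0 < k by rewrite divr_gt0.
have [c' Ac'] := happ (k ^+ 2) (exprn_gt0 _ k0).
have [sc' oc'] := orth c' Ac'; have scc := sq_componentsB sc sc'.
rewrite innerE// lte_fin => cc.
have -> : \sum_i \int[P]_w (a w i 0 * c w i 0) =
    \sum_i \int[P]_w (a w i 0 * (c \- c') w i 0).
  apply: eq_bigr => i _; rewrite -[LHS]subr0 -(oc' i).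
  rewrite -(RintegralB measurableT (square_integrableM (sa i) (sc i))
    (square_integrableM (sa i) (sc' i))).
  by apply: eq_Rintegral => w _; rewrite !mxE mulrBr.
apply: (le_trans (ler_norm_sum _ _ _)).
apply: (@le_trans _ _ (\sum_i (k * \int[P]_w (a w i 0 ^+ 2) +
    k^-1 * \int[P]_w ((c \- c') w i 0 ^+ 2)))).
  by apply: ler_sum => i _; exact: Rintegral_mul_le.
rewrite big_split/= -!mulr_sumr -/V.
apply: (@le_trans _ _ (k * V + k^-1 * k ^+ 2)).
  by rewrite lerD2l ler_wpM2l ?invr_ge0 ?ltW.
rewrite expr2 mulrA mulVf ?gt_eqF// mul1r -[X in _ + X]mulr1 -mulrDr.
by rewrite /k divfK// gt_eqF.
Qed.

Lemma sq_components_mulmx r (S : T -> 'cV[R]_r) (C : 'M[R]_(q, r)) :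
  (forall j, square_integrable P (fun w => S w j 0)) ->
  sq_components (fun w => C *m S w).
Proof. by move=> sS i; exact: square_integrable_mulmx. Qed.

Lemma orth_mulmx r (f : T -> R) (S : T -> 'cV[R]_r) (C : 'M[R]_(q, r)) i :
  square_integrable P f -> (forall j, square_integrable P (fun w => S w j 0)) ->
  (forall j, \int[P]_w (f w * S w j 0) = 0) ->
  \int[P]_w (f w * (C *m S w) i 0) = 0.
Proof.
move=> sf sS fS.
transitivity (\int[P]_w (\sum_j C i j * (f w * S w j 0))).
  apply: eq_Rintegral => w _; rewrite mxE mulr_sumr.
  by apply: eq_bigr => j _; ring.
have ifS j := square_integrableM sf (sS j).
rewrite Rintegral_sum => [|j]; last exact: integrableRZ.
by rewrite big1// => j _; rewrite (RintegralZl _ measurableT (ifS j)) fS mulr0.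
Qed.

Lemma condE_componentE d' (U : measurableType d') (Z : T -> U) a i :
  (fun w => condE P Z a w i 0) = condE1 P Z (fun w => a w i 0).
Proof. by apply/funext => w; rewrite mxE. Qed.

End hilbert_space_lemmas.

Section projections.
Context (R : realType) (q : nat).
Variables (nu : {sigma_finite_measure set R -> \bar R})
  (mu : {sigma_finite_measure set (q.-tuple R) -> \bar R}).
Variables (b : 'cV[R]_q) (g : R -> R) (eta : q.-tuple R -> R).
Variable P : probability (R * q.-tuple R)%type R.
Hypotheses (hm : plr_model nu mu b g eta) (hl : plr_law nu mu b g eta P).

Let mfst : measurable_fun setT (fst : R * q.-tuple R -> R) := measurable_fst.
Let msnd : measurable_fun setT (snd : R * q.-tuple R -> q.-tuple R) := measurable_snd.

Let uniform_bound (M : 'I_q -> R) : (forall i, 0 <= M i) ->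
  0 <= \sum_i M i /\ forall i, M i <= \sum_i M i.
Proof.
move=> M0; split=> [|i]; first exact: sumr_ge0.
by rewrite (bigD1 i)//= lerDl sumr_ge0.
Qed.

Lemma eta_scores_dense (u : 'I_q -> q.-tuple R -> R) :
  (forall i, measurable_fun setT (u i)) ->
  (forall i, square_integrable P (u i \o snd)) ->
  (forall i, \int[P]_z u i z.2 = 0) -> forall e : R, 0 < e ->
  exists c, [/\ nuisance_scores_eta nu mu b g eta P c, sq_components P c &
    forall i, \int[P]_z ((u i z.2 - c z i 0) ^+ 2) <= e].
Proof.
move=> mu_ su u0 e e0.
have /choice[Mv hMv] : forall i, exists Mv : R * (q.-tuple R -> R),
    [/\ 0 <= Mv.1, measurable_fun setT Mv.2, forall x, `|Mv.2 x| <= Mv.1,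
    \int[P]_z Mv.2 z.2 = 0 & \int[P]_z ((u i z.2 - Mv.2 z.2) ^+ 2) < e].
  move=> i; have [M [v hv]] := bounded_dense msnd (mu_ i) (su i) (u0 i) e0.
  by exists (M, v).
pose M := \sum_i (Mv i).1; pose s x : 'cV[R]_q := \col_i (Mv i).2 x.
have [M0 MvM] : 0 <= M /\ forall i, (Mv i).1 <= M.
  by apply: uniform_bound => i; case: (hMv i).
have sE x i : s x i 0 = (Mv i).2 x by rewrite mxE.
have ms i : measurable_fun setT (fun x => s x i 0).
  by under eq_fun do rewrite sE; case: (hMv i).
have sM x i : `|s x i 0| <= M.
  by rewrite sE; apply: le_trans (MvM i); case: (hMv i).
have ss : sq_components P (fun z => s z.2).
  move=> i; apply: (@bounded_square_integrable _ _ _ _ M) => [|z]; last exact: sM.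
  exact: (measurableT_comp (ms i)).
have [r [A [C [uA CA]]]] := gram_reduction ss.
have [M' M'0 AM] := mulmx_bounded A M0.
have sA i : \int[P]_z (A *m s z.2) i 0 = 0.
  have := @orth_mulmx _ _ _ P r q (fun=> 1) (fun z => s z.2) A i.
  under eq_Rintegral do rewrite mul1r.
  apply=> //.
    apply: (@bounded_square_integrable _ _ _ _ 1) => [|z]; last by rewrite normr1.
    exact: measurable_cst.
  move=> j; under eq_Rintegral do rewrite mul1r sE.
  by case: (hMv j).
have sc : sq_components P (fun z => C *m (A *m s z.2)).
  by apply: sq_components_mulmx => j; exact: square_integrable_mulmx.
(* The submodel is perturbed along As, whose information is nonsingular; the constant matrix allowed
   in the tangent space is C, which restores s almost surely. *)
exists (fun z => C *m (A *m s z.2)); split=> //.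
- apply: (eta_submodel_score hm hl (s := fun x => A *m s x) (M := M')) => //.
  + move=> i; under eq_fun do rewrite mxE.
    by apply: measurable_sum => k; apply: measurable_funM.
  + by move=> x i; apply: AM => k; exact: sM.
move=> i; apply/ltW; have [_ mv _ _ uv] := hMv i; apply: le_lt_trans uv.
rewrite le_eqVlt; apply/orP; left; apply/eqP.
have mui : measurable_fun setT (fun z : R * q.-tuple R => u i z.2) by have [] := su i.
have mvi : measurable_fun setT (fun z : R * q.-tuple R => (Mv i).2 z.2).
  exact: (measurableT_comp mv).
have [mci _] := sc i.
apply: ae_eq_Rintegral.
- by apply: measurable_funX; apply: measurable_funB; [exact: mui|exact: mci].
- by apply: measurable_funX; apply: measurable_funB; [exact: mui|exact: mvi].
- by apply: filterS CA => z ->; rewrite sE.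
Qed.

(** The error is (f - s) - (E(f | X) - n). As n(X) is a version of E(s | X), contraction bounds the
    second difference by the first, and 2 (e/4) + 2 (e/4) = e. *)
Lemma g_scores_dense (f : R * q.-tuple R -> 'cV[R]_q) (phi : 'I_q -> R -> R) :
  (forall i, measurable_fun setT (phi i)) ->
  (forall i z, f z i 0 = phi i z.1) -> Hspace P f -> forall e : R, 0 < e ->
  exists c, [/\ nuisance_scores_g nu mu b g eta P c, sq_components P c &
    forall i, \int[P]_z (((f \- E_givenX P f) z i 0 - c z i 0) ^+ 2) <= e].
Proof.
move=> mphi fE hf e e0; have sf := Hspace_square_integrable hf.
have sphi i : square_integrable P (phi i \o fst).
  by apply: square_integrable_eq (sf i) => z; exact: fE.
have phi0 i : \int[P]_z phi i z.1 = 0.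
  by rewrite -(Hspace_mean i hf); apply: eq_Rintegral => z _; rewrite fE.
have e4 : 0 < e / 4 by rewrite divr_gt0.
have /choice[Mv hMv] : forall i, exists Mv : R * (R -> R),
    [/\ 0 <= Mv.1, measurable_fun setT Mv.2, forall y, `|Mv.2 y| <= Mv.1 &
    \int[P]_z ((phi i z.1 - Mv.2 z.1) ^+ 2) < e / 4].
  move=> i; have [M [v [h1 h2 h3 _ h4]]] := bounded_dense mfst (mphi i) (sphi i) (phi0 i) e4.
  by exists (M, v).
pose M := \sum_i (Mv i).1; pose s y : 'cV[R]_q := \col_i (Mv i).2 y.
have [M0 MvM] : 0 <= M /\ forall i, (Mv i).1 <= M.
  by apply: uniform_bound => i; case: (hMv i).
have sE y i : s y i 0 = (Mv i).2 y by rewrite mxE.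
have ms i : measurable_fun setT (fun y => s y i 0).
  by under eq_fun do rewrite sE; case: (hMv i).
have sM y i : `|s y i 0| <= M.
  by rewrite sE; apply: le_trans (MvM i); case: (hMv i).
pose n x : 'cV[R]_q := \col_i cond_mean nu b g M (fun y => s y i 0) x.
have nE x i : n x i 0 = cond_mean nu b g M (fun y => s y i 0) x by rewrite mxE.
have nce i : is_condE P snd (fun z => s z.1 i 0) (fun x => n x i 0).
  under [X in is_condE _ _ _ X]eq_fun do rewrite nE.
  exact: (is_condE_cond_mean hm hl (ms i) (fun y => sM y i)).
have ss1 i : square_integrable P (fun z : R * q.-tuple R => s z.1 i 0).
  apply: (@bounded_square_integrable _ _ _ _ M) => [|z]; last exact: sM.
  exact: (measurableT_comp (ms i)).
have sn i : square_integrable P (fun z : R * q.-tuple R => n z.2 i 0).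
  by have [] := is_condE_square_integrable msnd (ss1 i) (nce i).
have sS : sq_components P (fun z => s z.1 - n z.2).
  move=> i; apply: square_integrable_eq (square_integrableB (ss1 i) (sn i)).
  by move=> z; rewrite !mxE.
have [r [A [C [uA CA]]]] := gram_reduction sS.
have sc : sq_components P (fun z => C *m (A *m (s z.1 - n z.2))).
  by apply: sq_components_mulmx => j; exact: square_integrable_mulmx.
exists (fun z => C *m (A *m (s z.1 - n z.2))); split=> //.
  exact: (g_submodel_score hm hl M0 ms sM uA).
move=> i; pose h := condE1 P snd (fun z => f z i 0).
have sh : square_integrable P h by exact: condE1_square_integrable.
have bE z : (f \- E_givenX P f) z i 0 = f z i 0 - h z by rewrite !mxE.
have s1 := square_integrableB (sf i) (ss1 i).
have s2 := square_integrableB sh (sn i).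
have -> : \int[P]_z (((f \- E_givenX P f) z i 0 - (C *m (A *m (s z.1 - n z.2))) i 0) ^+ 2) =
   \int[P]_z (((f z i 0 - s z.1 i 0) + - 1 * (h z - n z.2 i 0)) ^+ 2).
  have [mci _] := sc i; have [mfi _] := sf i; have [mh _] := sh.
  apply: ae_eq_Rintegral.
  - under eq_fun do rewrite bE.
    by apply: measurable_funX; apply: measurable_funB => //; exact: measurable_funB.
  - apply: measurable_funX; have [ms1 _] := s1; have [ms2 _] := s2.
    by apply: measurable_funD => //; exact: measurable_funM.
  - apply: filterS CA => z ->; rewrite bE [(s z.1 - n z.2) i 0]mxE [(- n z.2) i 0]mxE.
    by congr (_ ^+ 2); ring.
apply: le_trans (Rintegral_sqrD_le s1 (square_integrableZ (-1) s2)) _.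
have -> : \int[P]_z ((-1 * (h z - n z.2 i 0)) ^+ 2) =
   \int[P]_z ((h z - n z.2 i 0) ^+ 2).
  by apply: eq_Rintegral => z _; rewrite mulN1r sqrrN.
have hd : \int[P]_z ((h z - n z.2 i 0) ^+ 2) <= \int[P]_z ((f z i 0 - s z.1 i 0) ^+ 2).
  exact: (condE1_dist msnd (sf i) (ss1 i) (nce i)).
have fs : \int[P]_z ((f z i 0 - s z.1 i 0) ^+ 2) < e / 4.
  have [_ _ _ ] := hMv i; apply: le_lt_trans; rewrite le_eqVlt; apply/orP; left.
  by apply/eqP/eq_Rintegral => z _; rewrite fE sE.
lra.
Qed.

Lemma E_givenX_sq_components a : sq_components P a -> sq_components P (E_givenX P a).
Proof.
move=> sa i; rewrite /E_givenX condE_componentE.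
exact: condE1_square_integrable.
Qed.

Lemma E_givenX_Hspace a : Hspace P a -> Hspace P (E_givenX P a).
Proof.
move=> ha; have sa := Hspace_square_integrable ha.
apply: HspaceI; first exact: E_givenX_sq_components.
move=> i; rewrite /E_givenX.
rewrite (_ : (fun w => condE P snd a w i 0) = condE1 P snd (fun w => a w i 0)); last first.
  exact: condE_componentE.
rewrite (condE1_mean msnd (square_integrable_integrable (sa i))).
exact: Hspace_mean.
Qed.

Lemma projection_Lambda2 a : Hspace P a ->
  is_orth_proj P (Lambda2 nu mu b g eta P) a (E_givenX P a).
Proof.
move=> ha; have sa := Hspace_square_integrable ha; have hb := E_givenX_Hspace ha.
have sb := Hspace_square_integrable hb; split.
  apply: ms_closureI => // e e0.
  have /choice[u hu] : forall i, exists u : q.-tuple R -> R, measurable_fun setT u /\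
      forall z, E_givenX P a z i 0 = u z.2.
    move=> i; have [u [mu_ _ _] uE] := condE1P msnd (square_integrable_integrable (sa i)).
    by exists u; split => // z; rewrite mxE uE.
  have [c [h1 h2 h3]] := @eta_scores_dense u (fun i => (hu i).1)
    (fun i => square_integrable_eq (hu i).2 (sb i))
    (fun i => etrans (eq_Rintegral _ (fun z _ => esym ((hu i).2 z))) (Hspace_mean i hb)) e e0.
  exists c; split=> // i; apply: le_trans (h3 i); rewrite le_eqVlt; apply/orP; left.
  by apply/eqP/eq_Rintegral => z _; rewrite (hu i).2.
apply: ms_closure_orth; first exact: sq_componentsB.
move=> _ [r [ef [c0 [S [C [ef0 ef_model hS ->]]]]]].
have sS j : square_integrable P (fun w => S w j 0) by exact: (score_square_integrable hS).
split; first exact: sq_components_mulmx.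
move=> i; apply: orth_mulmx => //; first exact: sq_componentsB.
move=> j; have [u mu_ uE] := eta_score_factor hm ef_model hS j.
have [mS _] := sS j.
have muZ : measurable_fun setT (fun z : R * q.-tuple R => u z.2).
  exact: (measurableT_comp mu_).
have sab := sq_componentsB sa sb i; have [mab _] := sab.
rewrite (ae_eq_Rintegral (g := fun z => (a \- E_givenX P a) z i 0 * u z.2)).
- rewrite -(condE1_orth msnd (sa i) mu_ (ae_square_integrable muZ uE (sS j))).
  by apply: eq_Rintegral => z _; rewrite !mxE.
- exact: measurable_funM.
- exact: measurable_funM.
- by apply: filterS uE => z ->.
Qed.

(** v(X) is pulled out of E(S | X) = 0; this disposes of the part E(a | X) of the residual. *)
Lemma g_score_orth_X r (gf : 'cV[R]_r -> R -> R) c0 S j (v : q.-tuple R -> R) :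
  gf c0 = g -> (forall c, plr_model nu mu b (gf c) eta) ->
  is_score (nu \x mu)%E P (fun c => plr_dens nu b (gf c) eta) c0 S ->
  measurable_fun setT v -> square_integrable P (v \o snd) ->
  \int[P]_z (v z.2 * S z j 0) = 0.
Proof.
move=> gf0 gfm hS mv sv.
have sS := score_square_integrable hS j.
rewrite (is_condE_pull_out msnd (square_integrable_integrable sS)
  (g_score_condE0 hm hl gf0 gfm hS j) mv).
- by under eq_Rintegral do rewrite mulr0; exact: Rintegral_probability_cst.
- exact: square_integrableM.
- by under eq_fun do rewrite mulr0; exact: (finite_measure_integrable_cst P 0 measurableT).
Qed.

Lemma projection_Lambda1 a f : Hspace P a -> IB_preimage P (opK P a) f ->
  is_orth_proj P (Lambda1 nu mu b g eta P) a (f \- E_givenX P f).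
Proof.
move=> ha [[hf [phi fE]] IBf].
have sa := Hspace_square_integrable ha; have sf := Hspace_square_integrable hf.
have sfX := E_givenX_sq_components sf.
have sb := sq_componentsB sf sfX.
split.
  apply: ms_closureI.
    apply: HspaceI => // i; have h := E_givenX_Hspace hf.
    rewrite -[RHS](subrr (0 : R)) -{1}(Hspace_mean i hf) -(Hspace_mean i h).
    rewrite -(RintegralB measurableT (square_integrable_integrable (sf i))
      (square_integrable_integrable (sfX i))).
    by apply: eq_Rintegral => z _; rewrite !mxE.
  (* [L20Y] provides phi as a bare function; freezing x in the measurable f shows that its
     components are measurable. *)
  have mphi i : measurable_fun setT (fun y => phi y i 0).
    have [mf _] := sf i; rewrite fE in mf.
    exact: (measurable_fun_pair1 (point : q.-tuple R) mf).
  by apply: (g_scores_dense mphi) => // i z; rewrite fE.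
apply: ms_closure_orth; first exact: sq_componentsB.
move=> _ [r [gf [c0 [S [C [gf0 gf_model hS ->]]]]]].
have sS j : square_integrable P (fun w => S w j 0) by exact: (score_square_integrable hS).
split; first exact: sq_components_mulmx.
move=> i; apply: orth_mulmx => //; first exact: sq_componentsB.
move=> j; pose ai z := a z i 0; pose fi z := f z i 0.
have sai : square_integrable P ai := sa i; have sfi : square_integrable P fi := sf i.
pose aX := condE1 P snd ai; pose fX := condE1 P snd fi.
have saXi : square_integrable P aX by exact: condE1_square_integrable.
have sfXi : square_integrable P fX by exact: condE1_square_integrable.
pose D z := (ai z - aX z) - (fi z - fX z).
have sD : square_integrable P D by do 2 apply: square_integrableB.
have DX v : measurable_fun setT v -> square_integrable P (v \o snd) ->
    \int[P]_z (D z * v z.2) = 0.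
  move=> mv sv; rewrite -(subrr (0 : R)) -{1}(condE1_orth msnd sai mv sv).
  rewrite -(condE1_orth msnd sfi mv sv) -RintegralB//.
  - by apply: eq_Rintegral => z _; rewrite /D mulrBl.
  - by apply: square_integrableM => //; exact: square_integrableB.
  - by apply: square_integrableM => //; exact: square_integrableB.
(* Against v(Y) every term of D may be replaced by its conditional expectation given Y, while f,
   already a function of Y, is kept. What results is Ka - (f - Bf), which the preimage equation
   makes 0 almost surely. *)
have DY v : measurable_fun setT v -> square_integrable P (v \o fst) ->
    \int[P]_z (D z * v z.1) = 0.
  move=> mv sv.
  have proj k : square_integrable P k ->
      \int[P]_z (k z * v z.1) = \int[P]_z (condE1 P fst k z * v z.1).
    move=> sk; have sk' := condE1_square_integrable mfst sk.
    apply/eqP; rewrite -subr_eq0; apply/eqP; rewrite -[RHS](condE1_orth mfst sk mv sv).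
    rewrite -(RintegralB measurableT (square_integrableM sk sv) (square_integrableM sk' sv)).
    by apply: eq_Rintegral => z _; rewrite mulrBl.
  have sE k : square_integrable P k -> square_integrable P (condE1 P fst k).
    exact: condE1_square_integrable.
  have lin (k1 k2 k3 k4 : R * q.-tuple R -> R) : square_integrable P k1 ->
      square_integrable P k2 -> square_integrable P k3 -> square_integrable P k4 ->
      \int[P]_z (((k1 z - k2 z) - (k3 z - k4 z)) * v z.1) =
      (\int[P]_z (k1 z * v z.1) - \int[P]_z (k2 z * v z.1)) -
      (\int[P]_z (k3 z * v z.1) - \int[P]_z (k4 z * v z.1)).
    move=> s1 s2 s3 s4.
    have i12 := square_integrableM (square_integrableB s1 s2) sv.
    have i34 := square_integrableM (square_integrableB s3 s4) sv.
    rewrite -(RintegralB measurableT (square_integrableM s1 sv) (square_integrableM s2 sv)).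
    rewrite -(RintegralB measurableT (square_integrableM s3 sv) (square_integrableM s4 sv)).
    under [X in _ = X - _]eq_Rintegral do rewrite -mulrBl.
    under [X in _ = _ - X]eq_Rintegral do rewrite -mulrBl.
    rewrite -(RintegralB measurableT i12 i34).
    by apply: eq_Rintegral => z _; rewrite mulrBl.
  rewrite (lin _ _ _ _ sai saXi sfi sfXi) (proj _ sai) (proj _ saXi) (proj _ sfXi).
  rewrite -(lin _ _ _ _ (sE _ sai) (sE _ saXi) sfi (sE _ sfXi)).
  have [mvZ _] := sv.
  have [mI _] : square_integrable P (fun z => (condE1 P fst ai z - condE1 P fst aX z) -
      (fi z - condE1 P fst fX z)).
    exact: (square_integrableB (square_integrableB (sE _ sai) (sE _ saXi))
      (square_integrableB sfi (sE _ sfXi))).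
  rewrite (ae_eq_Rintegral (g := fun=> 0)); first exact: Rintegral_probability_cst.
  - exact: measurable_funM.
  - exact: measurable_cst.
  have EYX c : (fun z => E_givenY P (E_givenX P c) z i 0) =
      condE1 P fst (condE1 P snd (fun z => c z i 0)).
    by rewrite /E_givenY condE_componentE /E_givenX condE_componentE.
  have EY c : (fun z => E_givenY P c z i 0) = condE1 P fst (fun z => c z i 0).
    by rewrite /E_givenY condE_componentE.
  have opBE z : (f \- opB P f) z i 0 = fi z - condE1 P fst fX z.
    rewrite /fX -(EYX f) mxE; congr (_ + _); exact: mxE.
  have opKE z : opK P a z i 0 = condE1 P fst ai z - condE1 P fst aX z.
    rewrite /aX -(EYX a) /ai -(EY a) mxE; congr (_ + _); exact: mxE.
  apply: filterS IBf => z IBz.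
  by rewrite -opKE -opBE IBz subrr mul0r.
have [s [n [ms mn SE]]] := g_score_difference hm hl gf_model hS j.
have DS := orth_difference mfst msnd ms mn sD (sS j) SE DY DX.
have [h hE aXE] := condE1P msnd (square_integrable_integrable sai).
have aS : \int[P]_z (aX z * S z j 0) = 0.
  have [mh _ _] := hE; rewrite /aX aXE.
  by apply: (g_score_orth_X j gf0 gf_model hS mh); rewrite -aXE.
rewrite -[RHS](addr0 (0 : R)) -{1}DS -aS.
rewrite -(RintegralD measurableT (square_integrableM sD (sS j))
  (square_integrableM saXi (sS j))).
by apply: eq_Rintegral => z _; rewrite !mxE -/(ai z) -/(fi z) -/(fX z) /D; ring.
Qed.

End projections.

Theorem theorem3 (R : realType) (q : nat)
  (nu : {sigma_finite_measure set R -> \bar R})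
  (mu : {sigma_finite_measure set (q.-tuple R) -> \bar R})
  (beta0 : 'cV[R]_q) (g0 : R -> R) (eta0 : q.-tuple R -> R)
  (P : probability (R * q.-tuple R)%type R)
  (hmodel : plr_model nu mu beta0 g0 eta0)
  (hlaw : plr_law nu mu beta0 g0 eta0 P)
  (a : R * q.-tuple R -> 'cV[R]_q) (ha : Hspace P a) :
  (IBinv_dom P (opK P a) ->
     is_orth_proj P (Lambda1 nu mu beta0 g0 eta0 P) a
       (IBinv P (opK P a) \- E_givenX P (IBinv P (opK P a)))) /\
  is_orth_proj P (Lambda2 nu mu beta0 g0 eta0 P) a (E_givenX P a).
Proof.
split; last exact: projection_Lambda2.
(* The domain condition guarantees that [xget] in [IBinv] returns a genuine preimage; the projection
   statement holds for any preimage, so no uniqueness enters. *)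
by move=> dom; apply: projection_Lambda1 => //; exact: xgetPex.
Qed.
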